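(* Let $T$, $\varphi_0$, $L_\pm$ be as in the context, and let $\alpha_0\in\mathbb R$ satisfy $0<\alpha_0<\frac{\langle 1,\varphi_0\rangle}{\|\varphi_0\|^2}$. Let $\sigma_0$ be either of the two numbers $$\sigma_0=\pm\sqrt{\frac{\langle 1,\varphi_0\rangle^2}{\|\varphi_0\|^4}-\alpha_0^2},$$ and set $$a_0=\sigma_0\frac{\|\varphi_0\|^2}{\langle 1,\varphi_0\rangle},\qquad b_0=\alpha_0\frac{\|\varphi_0\|^2}{\langle 1,\varphi_0\rangle},\qquad D_2^0=8\,\frac{\langle \varphi_0^2L_+^{-1}[1],\,L_-^{-1}[b_0-\alpha_0\varphi_0]\rangle}{\langle 1,\varphi_0\rangle},$$ $$\Psi_1^0=a_0^2L_+^{-1}[1]+b_0L_-^{-1}[b_0-\alpha_0\varphi_0],\qquad \Psi_2^0=a_0b_0L_+^{-1}[1]-a_0L_-^{-1}[b_0-\alpha_0\varphi_0].$$ Then there exists $h_0=h_0(\alpha_0)>0$ such that for every $h$ with $0<h<h_0$ and $\alpha:=\alpha_0h$, there exists an even $2T$-periodic stationary solution $\varphi_\alpha=\varphi_{\alpha,1}+i\varphi_{\alpha,2}$ ($\varphi_{\alpha,1},\varphi_{\alpha,2}$ real-valued) of $iu_t+u_{xx}-u+2|u|^2u=-i\alpha u-h$; that is, $$\varphi_{\alpha,1}''-\varphi_{\alpha,1}+2(\varphi_{\alpha,1}^2+\varphi_{\alpha,2}^2)\varphi_{\alpha,1}=\alpha\varphi_{\alpha,2}-h,\qquad \varphi_{\alpha,2}''-\varphi_{\alpha,2}+2(\varphi_{\alpha,1}^2+\varphi_{\alpha,2}^2)\varphi_{\alpha,2}=-\alpha\varphi_{\alpha,1}.$$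 Moreover, as $h\to0^+$, $$\varphi_{\alpha,1}=\Big(a_0+\tfrac{b_0}{2}hD_2^0+O(h^2)\Big)\varphi_0+h\Psi_1^0+O_{\{\varphi_0\}^\perp}(h^2),$$ $$\varphi_{\alpha,2}=\Big(b_0-\tfrac{a_0}{2}hD_2^0+O(h^2)\Big)\varphi_0+h\Psi_2^0+O_{\{\varphi_0\}^\perp}(h^2).$$
   Context: Fix $a\in(1/\sqrt2,1)$, put $\kappa=\sqrt{2a^2-1}/a\in(0,1)$ and $T=K(\kappa)/a$ ($K$ the complete elliptic integral of the first kind), and let $\varphi_0(x)=a\,\mathrm{dn}(ax,\kappa)$, the positive even $2T$-periodic cnoidal-type solution of $\varphi''-\varphi+2\varphi^3=0$, decreasing on $[0,T]$. All functions are $2T$-periodic in $x$; $\langle f,g\rangle=\int_{-T}^{T}f\bar g\,dx$ and $\|f\|^2=\langle f,f\rangle$. On $L^2_{per}[-T,T]$ (domain $H^2_{per}$) let $$L_+=-\partial_x^2+1-6\varphi_0^2,\qquad L_-=-\partial_x^2+1-2\varphi_0^2 .$$ It is known that $\ker L_-=\mathrm{span}\{\varphi_0\}$ and $\ker L_+=\mathrm{span}\{\varphi_0'\}$; $L_\pm^{-1}$ denotes the inverse of $L_\pm$ on $(\ker L_\pm)^\perp$, with values in $(\ker L_\pm)^\perp$. Here $1\perp\ker L_+$ and $b_0-\alpha_0\varphi_0\perp\ker L_-$, so the expressions are well defined. $O_{\{\varphi_0\}^\perp}(h^2)$ denotes a function orthogonal to $\varphi_0$ whose $L^2$ norm is $O(h^2)$;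 scalar $O(h^2)$ terms are constants. *)

(* Defs.v *)
From HB Require Import structures.
From mathcomp Require Import all_boot all_order all_algebra.
From mathcomp Require Import all_classical all_reals all_analysis.

Set Implicit Arguments.
Unset Strict Implicit.
Unset Printing Implicit Defensive.

Import Order.TTheory GRing.Theory Num.Theory.
Import numFieldNormedType.Exports.

Local Open Scope classical_set_scope.
Local Open Scope ring_scope.

Section Elliptic.
Context {R : realType}.
Local Notation mu := (@lebesgue_measure R).

(* Here [k] is the modulus: it enters the integrand squared. *)
Definition ell_integrand (k t : R) : R :=
  (Num.sqrt (1 - k ^+ 2 * sin t ^+ 2))^-1.

(* The two branches give the oriented integral from 0 to [p]. *)
Definition ellF (k p : R) : R :=
  if 0 <= p then (\int[mu]_(t in `[0, p]) ell_integrand k t)%R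
  else - (\int[mu]_(t in `[p, 0]) ell_integrand k t)%R.

Definition ellK (k : R) : R := ellF k (pi / 2).

(* Jacobi's amplitude. For |k| < 1, [ellF k] is an increasing bijection of the
   line, so the chosen [p] is the only one. *)
Definition jacobi_am (u k : R) : R := xget 0 [set p | ellF k p = u].

Definition jacobi_dn (u k : R) : R :=
  Num.sqrt (1 - k ^+ 2 * sin (jacobi_am u k) ^+ 2).

Definition kappa (a : R) : R := Num.sqrt (2 * a ^+ 2 - 1) / a.

Definition half_period (a : R) : R := ellK (kappa a) / a.

Definition cnoidal (a x : R) : R := a * jacobi_dn (a * x) (kappa a).

End Elliptic.

Section PeriodicL2.
Context {R : realType}.
Local Notation mu := (@lebesgue_measure R).
Implicit Types (T : R) (f g u v w V : R -> R).

(* All functions are real-valued, so there is no conjugation. *)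
Definition inner T f g : R := (\int[mu]_(x in `[- T, T]) (f x * g x))%R.

Definition norm2 T f : R := Num.sqrt (inner T f f).

Definition L2per T f : Prop :=
  [/\ periodic f (2 * T), measurable_fun setT f &
      mu.-integrable `[- T, T] (EFin \o (fun x => f x ^+ 2))].

(* [u] is the absolutely continuous representative of an element of H^1_per,
   and [v] represents its weak derivative. *)
Definition wderiv_per T u v : Prop :=
  [/\ L2per T u, L2per T v &
      forall x y, x <= y -> u y - u x = (\int[mu]_(t in `[x, y]) v t)%R].

(* Graph of the operator - d^2/dx^2 + V on L^2_per with domain H^2_per:
   [u] is the C^1 representative of an element of H^2_per, and - u'' + V u = f
   in L^2_per, that is, almost everywhere. *)
Definition schrodinger T V u f : Prop :=
  L2per T f /\
  exists v w, [/\ wderiv_per T u v, wderiv_per T v w &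
                  {ae mu, forall x, - w x + V x * u x = f x}].

Definition in_ker T V u : Prop := schrodinger T V u (cst 0).

Definition in_ker_orth T V f : Prop :=
  L2per T f /\ forall v, in_ker T V v -> inner T f v = 0.

(* The inverse on (ker)^perp with values in (ker)^perp; the value is
   meaningful only when [f] is in the orthogonal of the kernel. *)
Definition schrodinger_inv T V f : R -> R :=
  xget (cst 0) [set u | schrodinger T V u f /\ in_ker_orth T V u].

Definition Lplus_inv T (phi0 : R -> R) f : R -> R :=
  schrodinger_inv T (fun x => 1 - 6 * phi0 x ^+ 2) f.

Definition Lminus_inv T (phi0 : R -> R) f : R -> R :=
  schrodinger_inv T (fun x => 1 - 2 * phi0 x ^+ 2) f.

End PeriodicL2.

Section Stationary.
Context {R : realType}.
Implicit Types p q : R -> R.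

Definition twice_derivable p : Prop :=
  forall x, derivable p x 1 /\ derivable (derive1 p) x 1.

(* p + i q is a time-independent solution u of
   i u_t + u_xx - u + 2 |u|^2 u = - i alpha u - h. *)
Definition stationary_solution (alpha h : R) p q : Prop :=
  [/\ twice_derivable p, twice_derivable q,
      forall x, derive1n 2 p x - p x + 2 * (p x ^+ 2 + q x ^+ 2) * p x
                = alpha * q x - h &
      forall x, derive1n 2 q x - q x + 2 * (p x ^+ 2 + q x ^+ 2) * q x
                = - (alpha * p x)].

Definition even_fun p : Prop := forall x, p (- x) = p x.

End Stationary.

(* Main.v *)
Require Import Defs.
From HB Require Import structures.
From mathcomp Require Import all_boot all_order all_algebra ring lra.
From mathcomp Require Import all_classical all_reals all_analysis.
From mathcomp Require Import measurable_realfun.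

Import Order.TTheory GRing.Theory Num.Theory.
Import numFieldNormedType.Exports.

(** Lyapunov-Schmidt reduction.  Put [e = a^2 - a^4], so that
    [phi0'^2 = phi0^2 - phi0^4 - e].  Writing the unknown as
    [(a0 + i b0) (phi0 + h (v + i w))], where [a0^2 + b0^2 = 1], the equation becomes
    [L+ v = a0 + h N(v, w)] and [L- w = alpha0 phi0 - b0 + h M(v, w)].  Even
    periodic solutions of these are sought with
    [v = a0 L+^-1[1] + h v1] and [w = - W + h w1 + t phi0], where
    [W = L-^-1[b0 - alpha0 phi0]], [v1 = L+^-1 N] and [w1 = L-^-1 M].  The solvability
    condition [<M, phi0> = 0] reads [t = - D / 2 + h G(v, w)], because
    [L+^-1[1] = (1 - 2 phi0^2) / (1 - 4 e)] is orthogonal to [phi0] and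
    [<phi0^3, L+^-1[1]> = - <1, phi0> / 4].  All this is a fixed point problem
    whose nonlinear part carries a factor [h], hence a contraction for small [h],
    and the terms in [v1], [w1] and [G] are the [O(h^2)] remainders.

    On even functions both inverses are explicit: [L-] is inverted by reduction
    of order with the positive solution [phi0], and [L+] by variation of
    parameters with [phi0'] and a second solution built from the primitive of
    [phi0^2]. *)

(** At [h = 0] every rotation and translate of [phi0] is a solution, so the linearization has a
    two-dimensional kernel: [phi0'] for [L+] and [phi0] for [L-]. Restricting to even functions
    removes [phi0'] and makes [L+] invertible; only the phase remains to be found. Solvability at
    first order, [b0 <1, phi0> = alpha0 <phi0, phi0>], together with [a0^2 + b0^2 = 1], fixes the
    phase up to the sign of [a0].

    At the next order [t] enters [<M, phi0>] through [4 phi0 v w], with the coefficient [4 a0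
    <phi0^3, L+^-1[1]> = - a0 <1, phi0>]. It is nonzero because [alpha0] lies strictly below its
    upper bound, which makes [a0] nonzero; hence [t] can be solved for.

    The contraction is carried out in the sup norm on continuous functions, so the explicit inverses
    need only sup bounds. The weakly defined inverses of the statement are compared with them only
    at [1] and at [b0 - alpha0 phi0]. *)

Local Open Scope classical_set_scope.
Local Open Scope ring_scope.

(** * Primitives of continuous functions *)

Section Primitives.
Context {R : realType}.
Local Notation mu := (@lebesgue_measure R).
Implicit Types (f g F G : R -> R) (x y : R).

(** The derivative is carried as a second explicit function, so that chains of derivatives can be
    built by rules and closed by [ring] or [field]. *)
Definition has_deriv F f : Prop := forall x, is_derive x (1 : R) F (f x).

Lemma has_deriv_eq F f g : has_deriv F f -> f =1 g -> has_deriv F g.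
Proof. by move=> Ff fg x; rewrite -fg; exact: Ff. Qed.

Lemma has_deriv_eql F G f : has_deriv F f -> F =1 G -> has_deriv G f.
Proof. by move=> Ff /funext <-. Qed.

Lemma has_deriv_cst (c : R) : has_deriv (fun=> c) (fun=> 0).
Proof. by move=> x; exact: is_derive_cst. Qed.

Lemma has_deriv_id : has_deriv (fun x => x) (fun=> 1).
Proof. by move=> x; exact: is_derive_id. Qed.

Lemma has_derivD F f G g : has_deriv F f -> has_deriv G g ->
  has_deriv (fun x => F x + G x) (fun x => f x + g x).
Proof. by move=> Ff Gg x; exact: is_deriveD (Ff x) (Gg x). Qed.

Lemma has_derivN F f : has_deriv F f -> has_deriv (fun x => - F x) (fun x => - f x).
Proof. by move=> Ff x; exact: is_deriveN (Ff x). Qed.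

Lemma has_derivM F f G g : has_deriv F f -> has_deriv G g ->
  has_deriv (fun x => F x * G x) (fun x => F x * g x + G x * f x).
Proof. by move=> Ff Gg x; exact: is_deriveM (Ff x) (Gg x). Qed.

Lemma has_derivX F f n : has_deriv F f ->
  has_deriv (fun x => F x ^+ n) (fun x => n%:R * F x ^+ n.-1 * f x).
Proof.
move=> Ff x; rewrite (_ : (fun y => F y ^+ n) = F ^+ n); last first.
  by apply/funext => y; rewrite fctE.
exact: is_deriveX (Ff x).
Qed.

Lemma has_derivV F f : (forall x, F x != 0) -> has_deriv F f ->
  has_deriv (fun x => (F x)^-1) (fun x => - (F x) ^- 2 * f x).
Proof. by move=> F0 Ff x; exact: is_deriveV (F0 x) (Ff x). Qed.

Lemma has_deriv_comp F f G g : has_deriv F f -> has_deriv G g ->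
  has_deriv (fun x => F (G x)) (fun x => f (G x) * g x).
Proof. by move=> Ff Gg x; exact: is_derive1_comp (Ff (G x)) (Gg x). Qed.

Lemma has_deriv_continuous F f : has_deriv F f -> continuous F.
Proof.
move=> Ff x; apply/differentiable_continuous/derivable1_diffP.
by case: (Ff x).
Qed.

Lemma has_deriv_val F f x : has_deriv F f -> derive1 F x = f x.
Proof. by move=> Ff; rewrite derive1E; have [_ ->] := Ff x. Qed.

Lemma has_deriv_derivable F f x : has_deriv F f -> derivable F x 1.
Proof. by move=> Ff; have [] := Ff x. Qed.

Lemma has_deriv_uniq F f g : has_deriv F f -> has_deriv F g -> f =1 g.
Proof.
by move=> Ff Fg x; rewrite -(has_deriv_val _ _ _ Ff) -(has_deriv_val _ _ _ Fg).
Qed.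

(** No order between [x] and [y] is imposed; the location of [c] is given by distances, which for
    [x = 0] is the form that bounds of primitives use. *)
Lemma has_deriv_mean F f x y : has_deriv F f ->
  exists2 c, `|c - x| <= `|y - x| & F y - F x = f c * (y - x).
Proof.
move=> Ff.
have H a b : a <= b -> exists2 c, c \in `[a, b] & F b - F a = f c * (b - a).
  move=> ab; apply: (@MVT_segment _ F f a b ab (fun z _ => Ff z)).
  by apply: continuous_subspaceT; exact: has_deriv_continuous Ff.
have [xy|/ltW yx] := leP x y.
  have [c] := H _ _ xy; rewrite in_itv/= => /andP[c1 c2] Fc; exists c => //.
  by rewrite !ger0_norm ?subr_ge0 // lerD2r.
have [c] := H _ _ yx; rewrite in_itv/= => /andP[c1 c2] Fc; exists c.
  by rewrite !ler0_norm ?subr_le0 // lerN2 lerD2r.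
by rewrite -[LHS]opprB Fc -mulrN opprB.
Qed.

(** Parity, translation and uniqueness of primitives all come from this: each time, both sides are
    primitives of one function. *)
Lemma has_deriv_inj F G f x y : has_deriv F f -> has_deriv G f ->
  F x - F y = G x - G y.
Proof.
move=> Ff Gf; have H : has_deriv (fun x => F x - G x) (fun=> 0).
  apply: has_deriv_eq (has_derivD _ _ _ _ Ff (has_derivN _ _ Gf)) _ => z.
  by rewrite subrr.
have [c _] := has_deriv_mean _ _ y x H; lra.
Qed.

Lemma has_deriv_lt F f x y : has_deriv F f -> (forall z, 0 < f z) ->
  x < y -> F x < F y.
Proof.
move=> Ff f0 xy; have [c _ Fc] := has_deriv_mean _ _ x y Ff.
by rewrite -subr_gt0 Fc mulr_gt0// subr_gt0.
Qed.

(* Written so that [ellF k] is convertible to [prim (ell_integrand k)]. *)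
Definition prim f x : R :=
  if 0 <= x then (\int[mu]_(t in `[0, x]) f t)%R
  else - (\int[mu]_(t in `[x, 0]) f t)%R.

Lemma continuous_integrable_itv f x y : continuous f ->
  mu.-integrable `[x, y] (EFin \o f).
Proof.
move=> cf; apply: continuous_compact_integrable; first exact: segment_compact.
exact: continuous_subspaceT.
Qed.

Lemma Rintegral_itv_sub f l x y : continuous f -> l <= x -> x <= y ->
  (\int[mu]_(t in `[x, y]) f t =
   \int[mu]_(t in `[l, y]) f t - \int[mu]_(t in `[l, x]) f t)%R.
Proof.
move=> cf lx xy; rewrite Rintegral_itvB ?bnd_simp//; last first.
  exact: continuous_integrable_itv.
rewrite Rintegral_itv_obnd_cbnd//.
apply: (integrableS _ _ _ (continuous_integrable_itv _ x y cf)) => //.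
by apply: subset_itvr; rewrite bnd_simp.
Qed.

(** Rebasing at a point below both 0 and [x] removes the case distinction in [prim]. *)
Lemma prim_sub f l x : continuous f -> l <= 0 -> l <= x ->
  prim f x = (\int[mu]_(t in `[l, x]) f t - \int[mu]_(t in `[l, 0]) f t)%R.
Proof.
move=> cf l0 lx; rewrite /prim; case: ifPn => [x0|].
  exact: Rintegral_itv_sub.
rewrite -ltNge => /ltW x0; rewrite (Rintegral_itv_sub f l x 0)// opprB.
by [].
Qed.

Lemma prim0 f : prim f 0 = 0.
Proof. by rewrite /prim lexx set_itv1 Rintegral_set1. Qed.

Lemma prim_has_deriv f : continuous f -> has_deriv (prim f) f.
Proof.
(* The [- 1] puts [l] strictly below [x], so the rebased formula holds on a whole neighbourhood of
   [x]. *)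
move=> cf x; pose l := Num.min x 0 - 1.
have lx : l < x by rewrite /l; case: (leP x 0) => ?; lra.
have l0 : l < 0 by rewrite /l; case: (leP x 0) => ?; lra.
pose F y : R := (\int[mu]_(t in `[l, y]) f t)%R.
have [dF eF] : derivable F x 1 /\ derive1 F x = f x.
  apply: (@continuous_FTC1 _ f (BLeft l) x (x + 1)) => //.
  - by rewrite ltrDl.
  - exact: continuous_integrable_itv.
  - exact: cf.
have Fx : is_derive x (1 : R) F (f x).
  by split => //; rewrite -derive1E.
have H : is_derive x (1 : R) (fun y => F y - F 0) (f x).
  rewrite -[f x]subr0; exact: is_deriveB Fx (is_derive_cst _ _ _).
apply: near_eq_is_derive H.
near=> y; rewrite (prim_sub f l) ?(ltW l0)//.
by apply: ltW; near: y; exact: lt_nbhsr.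
Unshelve. all: by end_near. Qed.

Lemma prim_continuous f : continuous f -> continuous (prim f).
Proof. by move=> cf; apply: has_deriv_continuous (prim_has_deriv _ cf). Qed.

Lemma prim_unique F f x : continuous f -> has_deriv F f -> prim f x = F x - F 0.
Proof.
move=> cf Ff; rewrite -(has_deriv_inj _ _ _ x 0 (prim_has_deriv _ cf) Ff).
by rewrite prim0 subr0.
Qed.

Lemma Rintegral_prim f x y : continuous f -> x <= y ->
  (\int[mu]_(t in `[x, y]) f t)%R = prim f y - prim f x.
Proof.
move=> cf xy; pose l := Num.min x 0.
have lx : l <= x by rewrite /l; case: (leP x 0) => ?; lra.
have l0 : l <= 0 by rewrite /l; case: (leP x 0) => ?; lra.
rewrite (Rintegral_itv_sub f l)// !(prim_sub f l)//; last exact: le_trans lx xy.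
by rewrite opprB addrA subrK.
Qed.

Lemma prim_bound f M x : continuous f -> (forall y, `|y| <= `|x| -> `|f y| <= M) ->
  `|prim f x| <= M * `|x|.
Proof.
move=> cf fM; have [c] := has_deriv_mean _ _ 0 x (prim_has_deriv _ cf).
by rewrite prim0 !subr0 => cx ->; rewrite normrM ler_wpM2r// fM.
Qed.

Lemma primB f g x : continuous f -> continuous g ->
  prim (fun y => f y - g y) x = prim f x - prim g x.
Proof.
move=> cf cg; rewrite (prim_unique (fun y => prim f y - prim g y)).
- by rewrite !prim0 subr0 subr0.
- by move=> y; apply: cvgB; [exact: cf|exact: cg].
- by apply: has_derivD; [|apply: has_derivN]; exact: prim_has_deriv.
Qed.

Lemma primZ f c x : continuous f -> prim (fun y => c * f y) x = c * prim f x.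
Proof.
move=> cf; rewrite (prim_unique (fun y => c * prim f y)).
- by rewrite prim0 mulr0 subr0.
- by move=> y; apply: cvgM; [exact: cvg_cst|exact: cf].
- apply: has_deriv_eq (has_derivM _ _ _ _ (has_deriv_cst c) (prim_has_deriv _ cf)) _.
  by move=> y; rewrite mulr0 addr0.
Qed.

Lemma prim_even f x : continuous f -> (forall y, f (- y) = - f y) ->
  prim f (- x) = prim f x.
Proof.
move=> cf fodd; have H : has_deriv (fun x => prim f (- x)) f.
  apply: has_deriv_eq (has_deriv_comp _ _ _ _ (prim_has_deriv _ cf)
    (has_derivN _ _ has_deriv_id)) _ => y.
  by rewrite mulrN1 fodd opprK.
have := has_deriv_inj _ _ _ x 0 H (prim_has_deriv _ cf); rewrite oppr0 prim0; lra.
Qed.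

Lemma prim_odd f x : continuous f -> (forall y, f (- y) = f y) ->
  prim f (- x) = - prim f x.
Proof.
move=> cf fev; have H : has_deriv (fun x => - prim f (- x)) f.
  apply: has_deriv_eq (has_derivN _ _ (has_deriv_comp _ _ _ _ (prim_has_deriv _ cf)
    (has_derivN _ _ has_deriv_id))) _ => y.
  by rewrite mulrN1 fev opprK.
have := has_deriv_inj _ _ _ x 0 H (prim_has_deriv _ cf); rewrite oppr0 prim0; lra.
Qed.

Lemma continuous_bounded_itv f L : continuous f ->
  exists2 M, 0 <= M & forall x, `|x| <= L -> `|f x| <= M.
Proof.
move=> cf; have [L0|L0] := ltP L 0.
  by exists 0 => // x xL; have := le_lt_trans xL L0; rewrite normr_lt0.
have cn : {within `[- L, L], continuous (fun x => `|f x|)}.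
  by apply: continuous_subspaceT => x; apply: cvg_norm; exact: cf.
have LL : - L <= L by lra.
have [c _ H] := EVT_max LL cn; exists `|f c| => // x xL.
by apply: H; rewrite in_itv /= -ler_norml.
Qed.

End Primitives.

(** The derivative is left as an evar and assembled along the syntax of the function. The case
    [*%R ?a] is the eta-contracted form of [fun x => a * x]; at the leaves a syntactic match with a
    hypothesis is tried first. *)
Ltac deriv := lazymatch goal with
  | |- has_deriv (fun x => @?F x + @?G x) _ => eapply has_derivD; deriv
  | |- has_deriv (fun x => - @?F x) _ => eapply has_derivN; deriv
  | |- has_deriv (fun x => @?F x ^+ ?n) _ => eapply has_derivX; deriv
  | |- has_deriv (fun x => @?F x * @?G x) _ => eapply has_derivM; deriv
  | |- has_deriv ( *%R ?a) _ =>
      exact: (has_derivM _ _ _ _ (has_deriv_cst a) has_deriv_id)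
  | |- has_deriv ?F _ => first
      [ match goal with H : has_deriv ?G _ |- _ => constr_eq F G; exact: H end
      | exact: has_deriv_cst | exact: has_deriv_id | eassumption ]
  end.

(** * Jacobi dn and the cnoidal wave *)

Section Jacobi.
Context {R : realType} (k : R).
Hypothesis k1 : k ^+ 2 < 1.

Let D (t : R) := 1 - k ^+ 2 * sin t ^+ 2.

Lemma has_deriv_sin : has_deriv (sin : R -> R) cos.
Proof. by move=> x; exact: is_derive_sin. Qed.

Lemma has_deriv_cos : has_deriv (cos : R -> R) (fun x => - sin x).
Proof. by move=> x; exact: is_derive_cos. Qed.

Lemma has_deriv_sqrt (F f : R -> R) : (forall x, 0 < F x) -> has_deriv F f ->
  has_deriv (fun x => Num.sqrt (F x)) (fun x => (2 * Num.sqrt (F x))^-1 * f x).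
Proof.
by move=> F0 Ff x; exact: is_derive1_comp (is_derive1_sqrt (F0 x)) (Ff x).
Qed.

Let D_gt0 t : 0 < D t.
Proof.
have k0 : 0 <= k ^+ 2 := sqr_ge0 k.
have s0 : 0 <= sin t ^+ 2 := sqr_ge0 _.
have s1 : sin t ^+ 2 <= 1 by have := cos2Dsin2 t; have := sqr_ge0 (cos t); lra.
rewrite /D subr_gt0 (le_lt_trans _ k1)//; exact: ler_piMr.
Qed.

Let D_deriv : has_deriv D (fun t => - (2 * k ^+ 2 * sin t * cos t)).
Proof.
apply: has_deriv_eq (has_derivD _ _ _ _ (has_deriv_cst 1) (has_derivN _ _
  (has_derivM _ _ _ _ (has_deriv_cst (k ^+ 2)) (has_derivX _ _ 2 has_deriv_sin)))) _.
by move=> t /=; ring.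
Qed.

Let g := ell_integrand k.

Let g_gt0 t : 0 < g t.
Proof. by rewrite /g /ell_integrand invr_gt0 sqrtr_gt0 D_gt0. Qed.

Let g_ge1 t : 1 <= g t.
Proof.
rewrite /g /ell_integrand invf_ge1 ?sqrtr_gt0 ?D_gt0//.
rewrite -[leRHS]sqrtr1 ler_sqrt ?ltr01// lerBlDr lerDl.
by rewrite mulr_ge0 ?sqr_ge0.
Qed.

Let g_cont : continuous g.
Proof.
apply: has_deriv_continuous; apply: has_derivV; last first.
  exact: (has_deriv_sqrt _ _ D_gt0 D_deriv).
by move=> t; rewrite gt_eqF// sqrtr_gt0 D_gt0.
Qed.

Let F := ellF k.

Let F_deriv : has_deriv F g.
Proof. exact: prim_has_deriv g_cont. Qed.

Let F0 : F 0 = 0. Proof. exact: prim0. Qed.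

Let F_inj : injective F.
Proof.
have lt := fun x y => has_deriv_lt _ _ x y F_deriv g_gt0.
move=> x y Fxy; apply/eqP; rewrite eq_le !leNgt; apply/andP; split; apply/negP => /lt.
  by rewrite Fxy ltxx.
by rewrite Fxy ltxx.
Qed.

(** The integrand is at least 1, so [F] dominates the identity in absolute value, and the
    intermediate value theorem between [- |u|] and [|u|] reaches [u]. *)
Let F_surj u : exists p, F p = u.
Proof.
have b : forall x, 0 <= x -> x <= F x.
  move=> x x0; have [c _] := has_deriv_mean _ _ 0 x F_deriv.
  by rewrite F0 !subr0 => ->; rewrite ler_peMl.
have b' : forall x, 0 <= x -> F (- x) <= - x.
  move=> x x0; have [c _] := has_deriv_mean _ _ 0 (- x) F_deriv.
  by rewrite F0 !subr0 => ->; rewrite mulrN lerN2 ler_peMl.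
have [|||p _ Fp] := @IVT _ F (- `|u|) `|u| u.
- by rewrite ge0_cp.
- by apply: continuous_subspaceT; exact: has_deriv_continuous F_deriv.
- have ub := b _ (normr_ge0 u); have lb := b' _ (normr_ge0 u).
  apply/andP; split.
    rewrite ge_min (le_trans lb)//.
    by rewrite lerNl -normrN ler_norm.
  by rewrite le_max (le_trans (ler_norm u) ub) orbT.
by exists p.
Qed.

Let am u := jacobi_am u k.

Let amK u : F (am u) = u.
Proof. by rewrite /am /jacobi_am; exact: (xgetPex 0 (F_surj u)). Qed.

Let FK p : am (F p) = p.
Proof. by apply: F_inj; rewrite amK. Qed.

Let dn u := jacobi_dn u k.

Let dn_gt0 u : 0 < dn u.
Proof. by rewrite sqrtr_gt0 D_gt0. Qed.

Let dn_sqr u : dn u ^+ 2 = 1 - k ^+ 2 * sin (am u) ^+ 2.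
Proof. by rewrite sqr_sqrtr// ltW// D_gt0. Qed.

Let am_deriv : has_deriv am dn.
Proof.
move=> u; rewrite -[u in is_derive u]amK.
rewrite (_ : dn u = (g (am u))^-1); last by rewrite /g /ell_integrand invrK.
apply: is_derive_inverse.
- by near=> x; rewrite FK.
- by near=> x; exact: (has_deriv_continuous _ _ F_deriv).
- exact: F_deriv.
- by rewrite gt_eqF.
Unshelve. all: by end_near. Qed.

(** This is [- k^2 sn cn], the derivative of dn. *)
Let dn1 u := - (k ^+ 2 * sin (am u) * cos (am u)).

Lemma jacobi_dn_deriv : has_deriv (jacobi_dn^~ k) dn1.
Proof.
apply: has_deriv_eq (has_deriv_sqrt _ _ _ (has_deriv_comp _ _ _ _ D_deriv am_deriv)) _.
  by move=> u; exact: D_gt0.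
move=> u; have := dn_gt0 u; rewrite -/(am u) -/(dn u) /dn1.
have -> : Num.sqrt (D (am u)) = dn u by [].
by move=> d0; field; rewrite gt_eqF.
Qed.

Lemma jacobi_dn1_deriv :
  has_deriv dn1 (fun u => (2 - k ^+ 2) * jacobi_dn u k - 2 * jacobi_dn u k ^+ 3).
Proof.
apply: has_deriv_eq (has_derivN _ _ (has_derivM _ _ _ _ (has_derivM _ _ _ _
   (has_deriv_cst (k ^+ 2)) (has_deriv_comp _ _ _ _ has_deriv_sin am_deriv))
   (has_deriv_comp _ _ _ _ has_deriv_cos am_deriv))) _.
move=> u /=; rewrite -/(dn u) [dn u ^+ 3]exprS dn_sqr.
have := cos2Dsin2 (am u); set s := sin _; set c := cos _ => cs.
have -> : k ^+ 2 * s ^+ 2 = k ^+ 2 * (1 - c ^+ 2) by rewrite -cs; ring.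
have e : k ^+ 2 * (s ^+ 2 + c ^+ 2) * dn u = k ^+ 2 * dn u by rewrite addrC cs mulr1.
by move: e; lra.
Qed.

Lemma ellF_oddE p : F (- p) = - F p.
Proof.
have H : has_deriv (fun x => - F (- x)) g.
  apply: has_deriv_eq (has_derivN _ _ (has_deriv_comp _ _ _ _ F_deriv
    (has_derivN _ _ has_deriv_id))) _.
  by move=> x; rewrite mulrN1 opprK /g /ell_integrand sinN sqrrN.
have := has_deriv_inj _ _ _ p 0 H F_deriv.
by rewrite oppr0 F0; lra.
Qed.

Lemma ellF_shift p : F (p + pi) = F p + F pi.
Proof.
have H : has_deriv (fun x => F (x + pi)) g.
  apply: has_deriv_eq (has_deriv_comp _ _ _ _ F_deriv
    (has_derivD _ _ _ _ has_deriv_id (has_deriv_cst pi))) _.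
  by move=> x; rewrite addr0 mulr1 /g /ell_integrand sinDpi sqrrN.
have := has_deriv_inj _ _ _ p 0 H F_deriv.
by rewrite add0r F0; lra.
Qed.

(** Shifting [- pi / 2] by [pi] and using oddness; hence dn, which depends on the square of the sine
    of the amplitude, has period [2 K]. *)
Lemma ellF_pi : F pi = 2 * ellK k.
Proof.
have := ellF_shift (- (pi / 2)); rewrite ellF_oddE /ellK -/F.
have -> : - (pi / 2) + pi = pi / 2 :> R by lra.
lra.
Qed.

Lemma ellK_gt0 : 0 < ellK k.
Proof.
have := has_deriv_lt _ _ 0 (pi / 2) F_deriv g_gt0.
by rewrite F0 /ellK -/F; apply; rewrite divr_gt0 ?pi_gt0.
Qed.

Lemma jacobi_dn_even u : jacobi_dn (- u) k = jacobi_dn u k.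
Proof.
rewrite /jacobi_dn -!/(am _); have -> : am (- u) = - am u.
  by apply: F_inj; rewrite ellF_oddE !amK.
by rewrite sinN sqrrN.
Qed.

Lemma jacobi_dn_periodic : periodic (jacobi_dn^~ k) (2 * ellK k).
Proof.
move=> u; rewrite /jacobi_dn -!/(am _).
have -> : am (u + 2 * ellK k) = am u + pi.
  by apply: F_inj; rewrite ellF_shift ellF_pi !amK.
by rewrite sinDpi sqrrN.
Qed.

Lemma jacobi_dn_gt0 u : 0 < jacobi_dn u k.
Proof. exact: dn_gt0. Qed.

(** The square is [k^4 sn^2 cn^2], where [k^2 sn^2 = 1 - dn^2] and [k^2 cn^2 = dn^2 - (1 - k^2)]. *)
Lemma jacobi_dn_energy u : dn1 u ^+ 2 =
  (1 - jacobi_dn u k ^+ 2) * (jacobi_dn u k ^+ 2 - (1 - k ^+ 2)).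
Proof.
have -> : jacobi_dn u k ^+ 2 = 1 - k ^+ 2 * sin (am u) ^+ 2 by exact: dn_sqr.
rewrite /dn1; have := cos2Dsin2 (am u); set s := sin _; set c := cos _ => cs.
have c2 : c ^+ 2 = 1 - s ^+ 2 by lra.
by rewrite sqrrN !exprMn c2; ring.
Qed.

End Jacobi.

(** * Rescaling dn to the cnoidal wave *)

Section Cnoidal.
Context {R : realType} (a : R).
Hypothesis ha : 1 / Num.sqrt 2 < a < 1.

Let a0 : 0 < a.
Proof.
by have /andP[+ _] := ha; apply: lt_trans; rewrite divr_gt0 ?sqrtr_gt0.
Qed.

Lemma cnoidal_modulus_bounds : 1 < 2 * a ^+ 2 < 2.
Proof.
have /andP[h1 h2] := ha; apply/andP; split; last first.
  rewrite -[ltRHS]mulr1 ltr_pM2l// expr_lt1// ltW//.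
have s2 : (0 : R) < Num.sqrt 2 by rewrite sqrtr_gt0.
have : 1 < a * Num.sqrt 2 by rewrite -ltr_pdivrMr.
rewrite -(@ltr_pXn2r _ 2%N) ?nnegrE ?ler01 ?mulr_ge0 ?(ltW s2) ?(ltW a0)//.
by rewrite expr1n exprMn sqr_sqrtr// mulrC.
Qed.

Lemma kappa_sqr : kappa a ^+ 2 = (2 * a ^+ 2 - 1) / a ^+ 2.
Proof.
rewrite /kappa exprMn sqr_sqrtr ?exprVn// subr_ge0 ltW//.
by have /andP[] := cnoidal_modulus_bounds.
Qed.

Lemma kappa_sqr_lt1 : kappa a ^+ 2 < 1.
Proof.
rewrite kappa_sqr ltr_pdivrMr ?exprn_gt0// mul1r.
have /andP[_ h] := cnoidal_modulus_bounds; lra.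
Qed.

Lemma half_period_gt0 : 0 < half_period a.
Proof. by rewrite /half_period divr_gt0// ellK_gt0// kappa_sqr_lt1. Qed.

(** Since [kappa^2 a^2 = 2 a^2 - 1], the rescaling turns the linear coefficient [2 - kappa^2] into 1
    and the energy into [(a^2 - phi^2) (phi^2 - (1 - a^2))]. These properties are all that the later
    sections use of elliptic functions. *)
Lemma cnoidal_ode : exists psi : R -> R,
  [/\ has_deriv (cnoidal a) psi,
      has_deriv psi (fun x => cnoidal a x - 2 * cnoidal a x ^+ 3),
      forall x, psi x ^+ 2 = cnoidal a x ^+ 2 - cnoidal a x ^+ 4 - (a ^+ 2 - a ^+ 4),
      forall x, 0 < cnoidal a x &
      even_fun (cnoidal a) /\ periodic (cnoidal a) (2 * half_period a)].
Proof.
have k1 := kappa_sqr_lt1; have an0 : a != 0 by rewrite gt_eqF.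
have ka : kappa a ^+ 2 * a ^+ 2 = 2 * a ^+ 2 - 1.
  by rewrite kappa_sqr divfK// expf_neq0.
pose ax x := a * x.
have dax : has_deriv ax (fun=> a).
  apply: has_deriv_eq (has_derivM _ _ _ _ (has_deriv_cst a) has_deriv_id) _ => x.
  by rewrite mulr1 mulr0 addr0.
pose d1 u := - (kappa a ^+ 2 * sin (jacobi_am u (kappa a)) * cos (jacobi_am u (kappa a))).
exists (fun x => a ^+ 2 * d1 (a * x)); split.
- apply: has_deriv_eq (has_derivM _ _ _ _ (has_deriv_cst a)
    (has_deriv_comp _ _ _ _ (jacobi_dn_deriv _ k1) dax)) _ => x.
  by rewrite mulr0 addr0 /d1 /ax; ring.
- apply: has_deriv_eq (has_derivM _ _ _ _ (has_deriv_cst (a ^+ 2))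
    (has_deriv_comp _ _ _ _ (jacobi_dn1_deriv _ k1) dax)) _ => x.
  rewrite /cnoidal /ax /=; set d := jacobi_dn _ _.
  rewrite mulr0 addr0.
  have -> : a ^+ 2 * (((2 - kappa a ^+ 2) * d - 2 * d ^+ 3) * a) =
    a * d * (2 * a ^+ 2 - kappa a ^+ 2 * a ^+ 2) - 2 * (a * d) ^+ 3 by ring.
  by rewrite ka; ring.
- move=> x; rewrite exprMn (jacobi_dn_energy _ k1) /cnoidal.
  set d := jacobi_dn _ _.
  have -> : (a ^+ 2) ^+ 2 * ((1 - d ^+ 2) * (d ^+ 2 - (1 - kappa a ^+ 2))) =
    (1 - d ^+ 2) * a ^+ 2 * (a ^+ 2 * d ^+ 2 - a ^+ 2 + kappa a ^+ 2 * a ^+ 2) by ring.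
  by rewrite ka; ring.
- by move=> x; rewrite /cnoidal mulr_gt0// jacobi_dn_gt0.
- split; first by move=> x; rewrite /cnoidal mulrN jacobi_dn_even.
  move=> x; rewrite /cnoidal mulrDr /half_period.
  have -> : a * (2 * (ellK (kappa a) / a)) = 2 * ellK (kappa a) by field.
  by rewrite jacobi_dn_periodic.
Qed.

End Cnoidal.

(** * Periodic functions *)

Section Periodic.
Context {R : realType} (T : R).
Hypothesis T0 : 0 < T.
Local Notation mu := (@lebesgue_measure R).
Implicit Types (f g F G u v : R -> R) (x y : R).

Definition periodic_continuous f : Prop := continuous f /\ periodic f (2 * T).

(** Taken over [[0, 2 T]] so that it is a value of [prim]; [innerE] links it to the integrals over
    [[- T, T]]. *)
Definition period_integral f : R := prim f (2 * T).

Lemma periodic_int f (k : int) x : periodic f (2 * T) ->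
  f (x + k%:~R * (2 * T)) = f x.
Proof.
move=> pf; have H n y : f (y + n%:R * (2 * T)) = f y.
  by rewrite mulr_natl periodicn.
case: k => n; first exact: H.
by rewrite NegzE -{2}(subrK (n.+1%:R * (2 * T)) x) H mulrNz mulNr.
Qed.

Lemma periodic_reduce x : exists (k : int) y, -T <= y <= T /\ x = y + k%:~R * (2 * T).
Proof.
pose k := Num.floor ((x + T) / (2 * T)); exists k, (x - k%:~R * (2 * T)).
split; last by rewrite subrK.
have T2 : 0 < 2 * T by rewrite mulr_gt0.
have /andP[h1 h2] : k%:~R <= (x + T) / (2 * T) < k%:~R + 1.
  by have := floor_itv ((x + T) / (2 * T)); rewrite intrD.
move: h1 h2; rewrite ler_pdivlMr// ltr_pdivrMr// mulrDl mul1r.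
by have := T0 => ? h1 h2; apply/andP; split; lra.
Qed.

Lemma periodic_continuous_bounded f : periodic_continuous f ->
  exists2 M, 0 <= M & forall x, `|f x| <= M.
Proof.
move=> [cf pf].
have cn : {within `[- T, T], continuous (fun x => `|f x|)}.
  apply: continuous_subspaceT => x; apply: cvg_norm; exact: cf.
have TT : - T <= T by have := T0; lra.
have [c _ H] := EVT_max TT cn; exists `|f c| => // x.
have [k [y [yT ->]]] := periodic_reduce x; rewrite periodic_int//.
by apply: H; rewrite in_itv.
Qed.

Lemma prim_shift f x : periodic_continuous f ->
  prim f (x + 2 * T) = prim f x + period_integral f.
Proof.
move=> [cf pf]; have H : has_deriv (fun x => prim f (x + 2 * T)) f.
  apply: has_deriv_eq (has_deriv_comp _ _ _ _ (prim_has_deriv _ cf)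
    (has_derivD _ _ _ _ has_deriv_id (has_deriv_cst (2 * T)))) _ => y.
  by rewrite addr0 mulr1 pf.
have := has_deriv_inj _ _ _ x 0 H (prim_has_deriv _ cf).
by rewrite add0r prim0 /period_integral; lra.
Qed.

Lemma innerE f g : periodic_continuous (fun x => f x * g x) ->
  inner T f g = period_integral (fun x => f x * g x).
Proof.
move=> pfg; rewrite /inner Rintegral_prim; [|by have [] := pfg|have := T0; lra].
have := prim_shift _ (- T) pfg; have -> : - T + 2 * T = T by lra.
by move=> ->; rewrite addrAC subrr add0r.
Qed.

Lemma period_integral_deriv F f : continuous f -> has_deriv F f ->
  periodic F (2 * T) -> period_integral f = 0.
Proof.
move=> cf Ff pF; rewrite /period_integral (prim_unique F)//.
by rewrite -{1}(add0r (2 * T)) pF subrr.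
Qed.

(** Both [f] and its translate are derivatives of [F]. *)
Lemma has_deriv_periodic F f : has_deriv F f -> periodic F (2 * T) ->
  periodic f (2 * T).
Proof.
move=> Ff pF x; have H : has_deriv F (fun x => f (x + 2 * T)).
  apply: has_deriv_eql (_ : F =1 F); last by [].
  apply: has_deriv_eql (has_deriv_eq _ _ _ (has_deriv_comp _ _ _ _ Ff
    (has_derivD _ _ _ _ has_deriv_id (has_deriv_cst (2 * T)))) _) _ => y //.
  by rewrite addr0 mulr1.
exact: has_deriv_uniq H Ff _.
Qed.

Lemma prim_ge0_mono f x y : continuous f -> (forall z, 0 <= f z) -> x <= y ->
  prim f x <= prim f y.
Proof.
move=> cf f0 xy; have [c _] := has_deriv_mean _ _ x y (prim_has_deriv _ cf).
by rewrite -subr_ge0 => ->; rewrite mulr_ge0// subr_ge0.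
Qed.

(** With zero mean, the primitive of a nonnegative function is both monotone and periodic, hence
    constant. *)
Lemma period_integral_eq0 f : periodic_continuous f -> (forall x, 0 <= f x) ->
  period_integral f = 0 -> forall x, f x = 0.
Proof.
move=> pf f0 If; have [cf _] := pf.
have pF : periodic (prim f) (2 * T) by move=> x; rewrite prim_shift// If addr0.
have H x y : prim f x = prim f y.
  wlog xy : x y / x <= y => [hw|].
    by have [/hw|/ltW/hw] := leP x y.
  apply/eqP; rewrite eq_le prim_ge0_mono//=.
  (* Enough periods to carry [x] past [y]; then [prim f y] is at most the value at the translate of
     [x], which is [prim f x]. *)
  pose n := Num.truncn ((y - x) / (2 * T)); have T2 : 0 < 2 * T by rewrite mulr_gt0.
  have : (y - x) / (2 * T) < n.+1%:R by rewrite truncnS_gt.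
  rewrite ltr_pdivrMr// => /ltW yn.
  rewrite -(periodicn pF n.+1 x); apply: prim_ge0_mono => //.
  by rewrite -mulr_natl; lra.
have D0 : has_deriv (prim f) (fun=> 0).
  by apply: has_deriv_eql (has_deriv_cst (prim f 0)) _ => x; exact: H.
exact: has_deriv_uniq (prim_has_deriv _ cf) D0.
Qed.

Lemma periodic_continuousM f g : periodic_continuous f -> periodic_continuous g ->
  periodic_continuous (fun x => f x * g x).
Proof.
move=> [cf pf] [cg pg]; split => x; last by rewrite pf pg.
by apply: cvgM; [exact: cf|exact: cg].
Qed.

Lemma periodic_continuousD f g : periodic_continuous f -> periodic_continuous g ->
  periodic_continuous (fun x => f x + g x).
Proof.
move=> [cf pf] [cg pg]; split => x; last by rewrite pf pg.
by apply: cvgD; [exact: cf|exact: cg].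
Qed.

Lemma periodic_continuous_cst c : periodic_continuous (fun=> c).
Proof. by split => // x; exact: cvg_cst. Qed.

Lemma periodic_continuousN f : periodic_continuous f ->
  periodic_continuous (fun x => - f x).
Proof.
move=> [cf pf]; split => x; last by rewrite pf.
by apply: cvgN; exact: cf.
Qed.

Lemma L2per_continuous f : periodic_continuous f -> L2per T f.
Proof.
move=> pf; have [cf pf'] := pf; split => //.
  exact: continuous_measurable_fun.
apply: continuous_integrable_itv => x.
by apply: (@cvg_comp _ _ _ f (fun y => y ^+ 2)); [exact: cf|exact: exprn_continuous].
Qed.

Lemma norm2_le f M : periodic_continuous f -> (forall x, `|f x| <= M) ->
  norm2 T f <= Num.sqrt (2 * T) * M.
Proof.
move=> pf fM; have M0 : 0 <= M by apply: le_trans (fM 0).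
have pff := periodic_continuousM _ _ pf pf.
have -> : Num.sqrt (2 * T) * M = Num.sqrt (M ^+ 2 * (2 * T)).
  by rewrite [RHS]sqrtrM ?sqr_ge0// sqrtr_sqr ger0_norm// mulrC.
rewrite /norm2 innerE// ler_wsqrtr// (le_trans (ler_norm _))//.
rewrite -[in leRHS](@ger0_norm _ (2 * T)); last by rewrite mulr_ge0// ltW.
apply: prim_bound; first by have [] := pff.
by move=> y _; rewrite normrM expr2 ler_pM.
Qed.

End Periodic.

(** * Classical regularity of the periodic Schrodinger operators *)

Section Regularity.
Context {R : realType} (T : R).
Hypothesis T0 : 0 < T.
Local Notation mu := (@lebesgue_measure R).
Implicit Types (f g F G u v w V : R -> R) (x y : R).

(** Continuity within the segment is one-sided at its ends; periodicity glues left continuity at [T]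
    to right continuity at [- T]. *)
Lemma periodic_within_continuous u : periodic u (2 * T) ->
  {within `[- T, T], continuous u} -> continuous u.
Proof.
move=> pu /continuous_within_itvP[|ci cl cr]; first by have := T0; lra.
have per s : s = 2 * T \/ s = - (2 * T) -> forall x, u (x + s) = u x.
  by case=> -> x; [exact: pu|rewrite -[in RHS](subrK (2 * T) x) pu].
have uT : u T = u (- T) by rewrite -(pu (- T)); congr u; lra.
have cT : {for - T, continuous u}.
  apply/left_right_continuousP; split; last exact: cl.
  apply/cvgrPdist_lt => e e0; move/cvgrPdist_lt : cr => /(_ e e0)[d /= d0 H].
  exists d => //= y; rewrite /ball_ => yd yT.
  rewrite -uT -(pu y); apply: H => /=; last by lra.
  by rewrite (_ : T - (y + 2 * T) = - T - y)//; lra.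
move=> z; have [k [y [/andP[Ty yT] ->]]] := periodic_reduce _ T0 z.
have H x : {for x, continuous u} -> {for x + k%:~R * (2 * T), continuous u}.
  move=> cx; rewrite /prop_for /continuous_at periodic_int//.
  apply/cvgrPdist_lt => e e0; move/cvgrPdist_lt : cx => /(_ e e0)[d /= d0 H].
  exists d => //= t; rewrite /ball_ => td.
  rewrite -(subrK (k%:~R * (2 * T)) t) periodic_int//; apply: H => /=.
  by rewrite (_ : x - (t - k%:~R * (2 * T)) = x + k%:~R * (2 * T) - t)//; ring.
apply: H; have [yT'|yT'] := ltP y T; last first.
  have -> : y = T by apply/eqP; rewrite eq_le yT.
  rewrite (_ : T = - T + 2 * T); last by lra.
  rewrite /prop_for /continuous_at pu.
  apply/cvgrPdist_lt => e e0; move/cvgrPdist_lt : cT => /(_ e e0)[d /= d0 H].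
  exists d => //= t; rewrite /ball_ => td.
  rewrite -(subrK (2 * T) t) pu; apply: H => /=.
  by rewrite (_ : - T - (t - 2 * T) = - T + 2 * T - t)//; lra.
move: Ty; rewrite le_eqVlt => /predU1P[<-//|Ty].
by apply: ci; rewrite in_itv /= Ty.
Qed.

Lemma wderiv_per_continuous u v : wderiv_per T u v -> continuous u.
Proof.
move=> [[pu _ _] [_ mv iv] uv]; apply: periodic_within_continuous => //.
have TT : - T <= T by have := T0; lra.
(* Square integrability gives integrability on a bounded interval: [|v| <= 1 + v^2], from the square
   of [|v| - 1/2]. *)
have intv : mu.-integrable `[- T, T] (EFin \o v).
  apply: (@le_integrable _ _ _ mu _ _ _ (EFin \o (fun x => 1 + v x ^+ 2))) => //.
  - by apply/measurable_EFinP; exact: measurable_funS mv.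
  - move=> x _; rewrite /= lee_fin [leRHS]ger0_norm ?addr_ge0 ?sqr_ge0//.
    rewrite -(real_normK (num_real (v x))); set n := `|v x|.
    by have := sqr_ge0 (n - 1 / 2); rewrite !expr2; lra.
  - rewrite (_ : EFin \o _ = (fun x => (1 : R)%:E + (v x ^+ 2)%:E)%E)//.
    apply: integrableD => //.
    by apply: (continuous_integrable_itv (fun=> 1)) => ?; exact: cvg_cst.
have := parameterized_integral_continuous TT intv.
move=> cF.
have cG : {within `[- T, T], continuous
    (fun x => u (- T) + (\int[mu]_(t in `[(- T), x]) v t)%R)}.
  by move=> x; apply: cvgD; [exact: cvg_cst|exact: cF].
apply: subspace_eq_continuous cG => x /set_mem; rewrite /= in_itv/= => /andP[Tx xT].
by rewrite /from_subspace -(uv _ _ Tx) addrC subrK.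
Qed.


(** Bootstrap: [u] and [v] are continuous as integrals, so under the integral [w] may be replaced by
    the continuous [V u - f], to which it is equal almost everywhere, and both derivatives become
    classical. *)
Lemma schrodinger_regular V u f : continuous V -> continuous f ->
  schrodinger T V u f -> periodic u (2 * T) /\ exists v,
    has_deriv u v /\ has_deriv v (fun x => V x * u x - f x).
Proof.
move=> cV cf [_ [v [w [uv vw ae]]]].
have cu := wderiv_per_continuous _ _ uv.
have cv := wderiv_per_continuous _ _ vw.
have [[pu _ _] _ uE] := uv; have [_ [_ mw _] vE] := vw.
split=> //; exists v.
have integral_deriv F g : continuous g ->
    (forall x y, x <= y -> F y - F x = (\int[mu]_(t in `[x, y]) g t)%R) -> has_deriv F g.
  move=> cg H; apply: has_deriv_eql (_ : has_deriv (fun x => F 0 + prim g x) g) _.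
    apply: has_deriv_eq (has_derivD _ _ _ _ (has_deriv_cst (F 0)) (prim_has_deriv _ cg)) _.
    by move=> x; rewrite add0r.
  move=> x; have [x0|/ltW x0] := leP 0 x.
    by have := H _ _ x0; rewrite Rintegral_prim// prim0 => h; lra.
  by have := H _ _ x0; rewrite Rintegral_prim// prim0 => h; lra.
split; first exact: integral_deriv.
have cg : continuous (fun x => V x * u x - f x).
  by move=> x; apply: cvgB; [apply: cvgM; [exact: cV|exact: cu]|exact: cf].
apply: integral_deriv => // x y xy; rewrite vE// /Rintegral; congr fine.
apply: ae_eq_integral => //.
- by apply/measurable_EFinP; exact: measurable_funS mw.
- apply/measurable_EFinP; apply: (@measurable_funS _ _ _ _ setT) => //.
  exact: continuous_measurable_fun.
- apply: (@filterS _ _ (ae_filter_ringOfSetsType mu) _ _ _ ae) => z zE _ /=.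
  by congr EFin; lra.
Qed.

Lemma schrodinger_classical V u v f : periodic_continuous T V ->
  periodic_continuous T f -> periodic u (2 * T) ->
  has_deriv u v -> has_deriv v (fun x => V x * u x - f x) -> schrodinger T V u f.
Proof.
move=> pcV pcf pu uv vw; split; first exact: L2per_continuous.
have cu := has_deriv_continuous _ _ uv; have cv := has_deriv_continuous _ _ vw.
have pcu : periodic_continuous T u by [].
have pcv : periodic_continuous T v by split => //; exact: has_deriv_periodic uv pu.
have pcw : periodic_continuous T (fun x => V x * u x - f x).
  apply: (periodic_continuousD _ _ _ (periodic_continuousM _ _ _ pcV pcu)).
  exact: periodic_continuousN.
exists v, (fun x => V x * u x - f x); split.
- split; [exact: L2per_continuous|exact: L2per_continuous|] => x y xy.
  by rewrite Rintegral_prim// !(prim_unique u v)//; lra.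
- split; [exact: L2per_continuous|exact: L2per_continuous|] => x y xy.
  rewrite Rintegral_prim//; last by case: pcw.
  by rewrite !(prim_unique v)//; [lra|case: pcw|case: pcw].
- by apply: aeW => x; lra.
Qed.

(** Green's identity: [u v' - v u'] is periodic with derivative [f v - u g]. *)
Lemma schrodinger_symmetric V u u1 f v v1 g :
  periodic_continuous T V -> periodic_continuous T f -> periodic_continuous T g ->
  periodic u (2 * T) -> has_deriv u u1 -> has_deriv u1 (fun x => V x * u x - f x) ->
  periodic v (2 * T) -> has_deriv v v1 -> has_deriv v1 (fun x => V x * v x - g x) ->
  period_integral T (fun x => f x * v x) = period_integral T (fun x => u x * g x).
Proof.
move=> pcV pcf pcg pu uu1 u12 pv vv1 v12.
have pcu : periodic_continuous T u by split => //; exact: has_deriv_continuous uu1.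
have pcv : periodic_continuous T v by split => //; exact: has_deriv_continuous vv1.
have [cfv _] := periodic_continuousM _ _ _ pcf pcv.
have [cug _] := periodic_continuousM _ _ _ pcu pcg.
apply/eqP; rewrite -subr_eq0 /period_integral -primB//; apply/eqP.
apply: (period_integral_deriv _ (fun x => u x * v1 x - v x * u1 x)).
- by move=> x; apply: cvgB; [exact: cfv|exact: cug].
- apply: has_deriv_eq (has_derivD _ _ _ _ (has_derivM _ _ _ _ uu1 v12)
    (has_derivN _ _ (has_derivM _ _ _ _ vv1 u12))) _ => x.
  by rewrite /=; ring.
- move=> x; rewrite pu pv (has_deriv_periodic _ _ _ uu1 pu) //.
  by rewrite (has_deriv_periodic _ _ _ vv1 pv).
Qed.

(* Being in the range of the operator, [U] is orthogonal to the weak kernel by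
   symmetry, so the kernel itself need not be computed. *)
Lemma schrodinger_invE V f U U1 Z Z1 :
  periodic_continuous T V -> periodic_continuous T f ->
  periodic U (2 * T) -> has_deriv U U1 -> has_deriv U1 (fun x => V x * U x - f x) ->
  periodic Z (2 * T) -> has_deriv Z Z1 -> has_deriv Z1 (fun x => V x * Z x - U x) ->
  schrodinger_inv T V f = U.
Proof.
move=> pcV pcf pU UU1 U12 pZ ZZ1 Z12.
have pcU : periodic_continuous T U by split => //; exact: has_deriv_continuous UU1.
have pc0 : periodic_continuous T (fun=> 0) := periodic_continuous_cst _ 0.
have [cV _] := pcV; have [cf _] := pcf.
have kerU : in_ker_orth T V U.
  split; first exact: L2per_continuous.
  move=> v kv.
  have [pv [v1 [vv1 v12]]] := schrodinger_regular _ _ _ cV pc0.1 kv.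
  have pcv : periodic_continuous T v by split => //; exact: has_deriv_continuous vv1.
  rewrite innerE//; last exact: periodic_continuousM.
  rewrite (schrodinger_symmetric _ _ _ _ _ _ _ pcV pcU pc0 pZ ZZ1 Z12 pv vv1 v12).
  rewrite /period_integral (_ : (fun x => _) = fun=> 0).
    by rewrite (prim_unique (fun=> 0)) ?subrr//; [case: pc0|exact: has_deriv_cst].
  by apply/funext => x; rewrite mulr0.
apply: xget_unique; first by split => //; exact: schrodinger_classical UU1 U12.
move=> u [Lu [_ uk]]; have [pu [u1 [uu1 u12]]] := schrodinger_regular _ _ _ cV cf Lu.
have pcu : periodic_continuous T u by split => //; exact: has_deriv_continuous uu1.
(* Uniqueness: [d] lies in the kernel, to which both [u] and [U] are orthogonal, so [d] is
   orthogonal to itself. *)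
pose d x := u x - U x.
have pcd : periodic_continuous T d.
  by apply: (periodic_continuousD _ _ _ pcu); exact: periodic_continuousN.
have kd : in_ker T V d.
  have [cd pd] := pcd.
  apply: (schrodinger_classical _ _ (fun x => u1 x - U1 x)) => //.
  - by apply: has_derivD => //; exact: has_derivN.
  - apply: has_deriv_eq (has_derivD _ _ _ _ u12 (has_derivN _ _ U12)) _ => x.
    by rewrite /d /=; ring.
have := uk _ kd; have := kerU.2 _ kd.
rewrite !(innerE _ T0); [|exact: periodic_continuousM..] => Ud ud.
have pcud := periodic_continuousM _ _ _ pcu pcd.
have pcUd := periodic_continuousM _ _ _ pcU pcd.
apply/funext => x; apply/eqP; rewrite -subr_eq0 -/(d x) -[_ == 0](expf_eq0 _ 2).
apply/eqP; move: x; apply: (period_integral_eq0 _ T0).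
- exact: (periodic_continuousM _ _ _ pcd pcd).
- by move=> x; exact: sqr_ge0.
- rewrite (_ : (fun x => d x ^+ 2) = fun x => u x * d x - U x * d x).
    rewrite /period_integral primB; [|by case: pcud|by case: pcUd].
    by rewrite [X in X - _]ud [X in _ - X]Ud subrr.
  by apply/funext => x; rewrite /d; ring.
Qed.

End Regularity.

(** * Explicit inverses on even periodic functions *)

Section EvenPeriodic.
Context {R : realType} (T : R).
Hypothesis T0 : 0 < T.
Implicit Types (f g : R -> R).

Definition even_periodic f : Prop := periodic_continuous T f /\ even_fun f.

Lemma even_periodic_cst c : even_periodic (fun=> c).
Proof. by split=> //; exact: periodic_continuous_cst. Qed.

Lemma even_periodicD f g : even_periodic f -> even_periodic g ->
  even_periodic (fun x => f x + g x).
Proof.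
move=> [pf ef] [pg eg]; split; first exact: periodic_continuousD.
by move=> x; rewrite ef eg.
Qed.

Lemma even_periodicM f g : even_periodic f -> even_periodic g ->
  even_periodic (fun x => f x * g x).
Proof.
move=> [pf ef] [pg eg]; split; first exact: periodic_continuousM.
by move=> x; rewrite ef eg.
Qed.

Lemma even_periodicN f : even_periodic f -> even_periodic (fun x => - f x).
Proof.
move=> [pf ef]; split; first exact: periodic_continuousN.
by move=> x; rewrite ef.
Qed.

Lemma even_periodicX f n : even_periodic f -> even_periodic (fun x => f x ^+ n).
Proof.
move=> pf; elim: n => [|n IH]; first exact: even_periodic_cst.
rewrite (_ : (fun x => _) = fun x => f x * f x ^+ n); first exact: even_periodicM.
by apply/funext => x; rewrite exprS.
Qed.

Lemma even_periodic_continuous f : even_periodic f -> continuous f.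
Proof. by case=> -[]. Qed.

Lemma period_integralB f g : continuous f -> continuous g ->
  period_integral T (fun x => f x - g x) = period_integral T f - period_integral T g.
Proof. by move=> cf cg; rewrite /period_integral primB. Qed.

Lemma period_integral_bound f M : continuous f -> (forall x, `|f x| <= M) ->
  `|period_integral T f| <= M * (2 * T).
Proof.
move=> cf fM; rewrite -[2 * T in leRHS](@ger0_norm _ (2 * T)).
  by apply: prim_bound.
by rewrite mulr_ge0// ltW.
Qed.

Lemma period_integral_odd f : periodic_continuous T f ->
  (forall x, f (- x) = - f x) -> period_integral T f = 0.
Proof.
move=> pf odf; have := prim_shift _ _ (- T) pf.
have -> : - T + 2 * T = T by ring.
by rewrite prim_even//; [lra|case: pf].
Qed.

(** Additivity is stated for differences, the form in which Lipschitz estimates use it; the bound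
    ranges over all pointwise bounds [M], so no supremum has to be formed. *)
Definition bounded_operator (S S' : (R -> R) -> Prop) (K : (R -> R) -> R -> R) :=
  [/\ forall f, S f -> S' (K f),
      forall f g, S f -> S g -> K (fun x => f x - g x) = (fun x => K f x - K g x) &
      exists2 C, 0 <= C & forall f M, S f -> (forall x, `|f x| <= M) ->
        forall x, `|K f x| <= C * M].

Lemma bounded_operator_comp S S' S'' K L : bounded_operator S S' K ->
  bounded_operator S' S'' L -> bounded_operator S S'' (fun f => L (K f)).
Proof.
move=> [KS KB [C C0 KC]] [LS LB [C' C'0 LC]]; split.
- by move=> f Sf; apply/LS/KS.
- by move=> f g Sf Sg; rewrite KB// LB//; exact: KS.
- exists (C' * C); first exact: mulr_ge0.
  move=> f M Sf fM x; rewrite -mulrA; apply: LC; first exact: KS.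
  exact: KC.
Qed.

Lemma bounded_operator_integral :
  bounded_operator even_periodic even_periodic (fun f _ => period_integral T f).
Proof.
split.
- by move=> f _; exact: even_periodic_cst.
- move=> f g ef eg; apply/funext => _.
  by rewrite period_integralB//; exact: even_periodic_continuous.
- exists (2 * T); first by rewrite mulr_ge0// ltW.
  move=> f M ef fM _; rewrite mulrC; apply: period_integral_bound => //.
  exact: even_periodic_continuous.
Qed.

End EvenPeriodic.

Ltac even_periodic := lazymatch goal with
  | |- even_periodic _ (fun x => @?F x + @?G x) => eapply even_periodicD; even_periodic
  | |- even_periodic _ (fun x => - @?F x) => eapply even_periodicN; even_periodic
  | |- even_periodic _ (fun x => @?F x ^+ ?n) => eapply even_periodicX; even_periodic
  | |- even_periodic _ (fun x => @?F x * @?G x) => eapply even_periodicM; even_periodic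
  | |- even_periodic _ ?f => first
      [ match goal with H : even_periodic _ ?g |- _ => constr_eq f g; exact: H end
      | exact: even_periodic_cst | eassumption ]
  end.

Section Linearized.
Context {R : realType} (T e : R) (phi psi : R -> R).
Hypothesis T0 : 0 < T.
Hypothesis e0 : 0 < e.
Hypothesis e1 : 4 * e < 1.
Hypothesis phi_deriv : has_deriv phi psi.
Hypothesis psi_deriv : has_deriv psi (fun x => phi x - 2 * phi x ^+ 3).
Hypothesis energy : forall x, psi x ^+ 2 = phi x ^+ 2 - phi x ^+ 4 - e.
Hypothesis phi_gt0 : forall x, 0 < phi x.
Hypothesis phi_even : even_fun phi.
Hypothesis phi_periodic : periodic phi (2 * T).
Implicit Types (f g : R -> R).

Let phi_neq0 x : phi x != 0. Proof. by rewrite gt_eqF. Qed.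

Let ep_phi : even_periodic T phi.
Proof. by split=> //; split=> //; exact: has_deriv_continuous phi_deriv. Qed.

Let psi_cont : continuous psi. Proof. exact: has_deriv_continuous psi_deriv. Qed.

Let psi_periodic : periodic psi (2 * T).
Proof. exact: has_deriv_periodic phi_deriv phi_periodic. Qed.

Let psi_odd x : psi (- x) = - psi x.
Proof.
have H : has_deriv phi (fun x => - psi (- x)).
  apply: has_deriv_eql (_ : has_deriv (fun x => phi (- x)) _) phi_even.
  apply: has_deriv_eq (has_deriv_comp _ _ _ _ phi_deriv (has_derivN _ _ has_deriv_id)) _.
  by move=> y; rewrite mulrN1.
by have := has_deriv_uniq _ _ _ H phi_deriv x; lra.
Qed.

Let J := prim (fun x => phi x ^+ 2).

Let phi2_cont : continuous (fun x => phi x ^+ 2).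
Proof. by apply: even_periodic_continuous; exact: (even_periodicX _ _ 2 ep_phi). Qed.

Let J_deriv : has_deriv J (fun x => phi x ^+ 2).
Proof. exact: prim_has_deriv. Qed.

(** The gain over one period of the even solution [chi] of [L+ u = 0] is [c psi]; that [c] is
    nonzero makes [L+] invertible on even periodic functions. *)
Let c := J (2 * T) - 4 * e * T.

(* As (psi / phi)' = e / phi ^ 2 - phi ^ 2, the functions phi ^ 2 and
   e / phi ^ 2 have the same mean, and their sum exceeds 4 e pointwise. *)
Let c_gt0 : 0 < c.
Proof.
(* Completing the square shows that the derivative is positive; as [psi / phi] is periodic, the
   function gains exactly [2 c] over a period. *)
have H : has_deriv (fun x => psi x * (phi x)^-1 + 2 * J x - 4 * e * x)
  (fun x => ((phi x ^+ 2 - 2 * e) ^+ 2 + e * (1 - 4 * e)) / phi x ^+ 2).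
  apply: has_deriv_eq (has_derivD _ _ _ _ (has_derivD _ _ _ _
    (has_derivM _ _ _ _ psi_deriv (has_derivV _ _ phi_neq0 phi_deriv))
    (has_derivM _ _ _ _ (has_deriv_cst 2) J_deriv))
    (has_derivN _ _ (has_derivM _ _ _ _ (has_deriv_cst (4 * e)) has_deriv_id))) _ => x.
  have -> : psi x * (- phi x ^- 2 * psi x) = - (psi x ^+ 2) / phi x ^+ 2.
    by field.
  by rewrite energy; field.
have /(has_deriv_lt _ _ 0 (2 * T) H) : forall z,
    0 < ((phi z ^+ 2 - 2 * e) ^+ 2 + e * (1 - 4 * e)) / phi z ^+ 2.
  move=> z; rewrite divr_gt0 ?exprn_gt0// ltr_wpDl ?sqr_ge0// mulr_gt0//.
  by have := e1; lra.
have T2 : 0 < 2 * T by rewrite mulr_gt0.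
have psiT : psi (2 * T) = psi 0 by rewrite -[2 * T]add0r psi_periodic.
have phiT : phi (2 * T) = phi 0 by rewrite -[2 * T]add0r phi_periodic.
by move=> /(_ T2); rewrite psiT phiT /c /J prim0 mulr0; lra.
Qed.

(* From L+ (J psi - phi ^ 3 + phi) = - 4 e phi and L+ (phi + x psi) = - 2 phi. *)
Let chi x := (J x - 2 * e * x) * psi x + (1 - 2 * e) * phi x - phi x ^+ 3.

Let chi1 x := (J x - 2 * e * x) * (phi x - 2 * phi x ^+ 3) +
  (1 - 4 * e - 2 * phi x ^+ 2) * psi x.

Let chi_deriv : has_deriv chi chi1.
Proof.
apply: has_deriv_eq; first by rewrite /chi; deriv.
by move=> x; rewrite /chi1 /=; ring.
Qed.

Let chi1_deriv : has_deriv chi1 (fun x => (1 - 6 * phi x ^+ 2) * chi x).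
Proof.
apply: has_deriv_eq; first by rewrite /chi1; deriv.
move=> x; rewrite /chi /=; ring: (energy x).
Qed.

(** Positive because [0 < 4 e < 1], so [chi] and [psi] form a fundamental system of [L+ u = 0]. *)
Let wronskian x : chi x * (phi x - 2 * phi x ^+ 3) - chi1 x * psi x = e * (1 - 4 * e).
Proof. rewrite /chi /chi1; ring: (energy x). Qed.

Let chi_shift x : chi (x + 2 * T) = chi x + c * psi x.
Proof.
rewrite /chi psi_periodic phi_periodic.
have -> : J (x + 2 * T) = J x + J (2 * T).
  by apply: prim_shift; case: (even_periodicX _ _ 2 ep_phi).
by rewrite /c; ring.
Qed.

Let chi_cont : continuous chi. Proof. exact: has_deriv_continuous chi_deriv. Qed.

Let J_odd x : J (- x) = - J x.
Proof. by apply: prim_odd => // y; rewrite phi_even. Qed.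

Let chi_even x : chi (- x) = chi x.
Proof. by rewrite /chi J_odd psi_odd phi_even; ring. Qed.

Let Wr := e * (1 - 4 * e).

Let Wr_neq0 : Wr != 0.
Proof. by rewrite gt_eqF// mulr_gt0//; have := e1; lra. Qed.

Section VariationOfParameters.
Variables (f : R -> R).
Hypothesis ep_f : even_periodic T f.

Let P := prim (fun x => psi x * f x).
Let Q := prim (fun x => chi x * f x).

Let f_cont := even_periodic_continuous _ _ ep_f.

Let psif_cont : continuous (fun x => psi x * f x).
Proof. by move=> x; apply: cvgM; [exact: psi_cont|exact: f_cont]. Qed.

Let chif_cont : continuous (fun x => chi x * f x).
Proof. by move=> x; apply: cvgM; [exact: chi_cont|exact: f_cont]. Qed.

Let P_deriv : has_deriv P (fun x => psi x * f x). Proof. exact: prim_has_deriv. Qed.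

Let Q_deriv : has_deriv Q (fun x => chi x * f x). Proof. exact: prim_has_deriv. Qed.

Let psif_odd x : psi (- x) * f (- x) = - (psi x * f x).
Proof. by rewrite psi_odd ep_f.2 mulNr. Qed.

Let psif_pc : periodic_continuous T (fun x => psi x * f x).
Proof. by split=> // x; rewrite psi_periodic ep_f.1.2. Qed.

Let P_shift x : P (x + 2 * T) = P x.
Proof.
by rewrite /P prim_shift// period_integral_odd// addr0.
Qed.

(** The translate of the integrand [chi f] is [chi f + c psi f], whence the extra [c P]. *)
Let Q_shift x : Q (x + 2 * T) = Q x + Q (2 * T) + c * P x.
Proof.
have H : has_deriv (fun x => Q x + c * P x) (fun x => chi (x + 2 * T) * f (x + 2 * T)).
  apply: has_deriv_eq; first by deriv.
  by move=> y; rewrite chi_shift ep_f.1.2 /=; ring.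
have H' : has_deriv (fun x => Q (x + 2 * T)) (fun x => chi (x + 2 * T) * f (x + 2 * T)).
  apply: has_deriv_eq (has_deriv_comp _ _ _ _ Q_deriv
    (has_derivD _ _ _ _ has_deriv_id (has_deriv_cst (2 * T)))) _ => y.
  by rewrite addr0 mulr1.
have := has_deriv_inj _ _ _ x 0 H' H.
by rewrite add0r /P /Q !prim0; lra.
Qed.

(** The first term is the multiple of the homogeneous solution [chi] that restores periodicity: over
    a period it gains [Q (2 * T) * psi], cancelling the constant gain of [Q] in [- psi * Q]; the
    gains of [chi] and [Q] involving [P] cancel each other. *)
Definition Lplus_solution x : R :=
  (Q (2 * T) / c * chi x + chi x * P x - psi x * Q x) / Wr.

Let sol1 x := (Q (2 * T) / c * chi1 x + chi1 x * P x -
  (phi x - 2 * phi x ^+ 3) * Q x) / Wr.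

Lemma Lplus_solution_deriv : exists u1, has_deriv Lplus_solution u1 /\
  has_deriv u1 (fun x => (1 - 6 * phi x ^+ 2) * Lplus_solution x - f x).
Proof.
exists sol1; split.
  apply: has_deriv_eq; first by rewrite /Lplus_solution; deriv.
  by move=> x; rewrite /sol1 /=; ring.
apply: has_deriv_eq; first by rewrite /sol1; deriv.
move=> x; rewrite /Lplus_solution /=.
have E : (chi x * (phi x - 2 * phi x ^+ 3) - chi1 x * psi x) * f x / Wr = f x.
  by rewrite wronskian -/Wr mulrAC mulfV// mul1r.
rewrite -[X in _ = _ - X]E; ring.
Qed.

Lemma Lplus_solution_even_periodic : even_periodic T Lplus_solution.
Proof.
split; first split.
- by have [u1 [+ _]] := Lplus_solution_deriv; exact: has_deriv_continuous.
- move=> x; rewrite /Lplus_solution chi_shift psi_periodic P_shift Q_shift.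
  congr (_ / _); field; by rewrite gt_eqF.
- move=> x; have PE : P (- x) = P x by exact: prim_even.
  have QE : Q (- x) = - Q x.
    by apply: prim_odd => // y; rewrite chi_even ep_f.2.
  by rewrite /Lplus_solution chi_even psi_odd PE QE; congr (_ / _); ring.
Qed.

End VariationOfParameters.

Lemma Lplus_solution_bounded :
  bounded_operator (even_periodic T) (even_periodic T) Lplus_solution.
Proof.
have cpsi f : even_periodic T f -> continuous (fun x => psi x * f x).
  by move=> ef x; apply: cvgM; [exact: psi_cont|exact: (even_periodic_continuous _ _ ef)].
have cchi f : even_periodic T f -> continuous (fun x => chi x * f x).
  by move=> ef x; apply: cvgM; [exact: chi_cont|exact: (even_periodic_continuous _ _ ef)].
split.
- exact: Lplus_solution_even_periodic.
- move=> f g ef eg; apply/funext => x; rewrite /Lplus_solution.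
  have E h (ch : forall k, even_periodic T k -> continuous (fun x => h x * k x)) y :
    prim (fun x => h x * (f x - g x)) y =
      prim (fun x => h x * f x) y - prim (fun x => h x * g x) y.
    rewrite -primB//; [|exact: ch|exact: ch]; congr prim.
    by apply/funext => z; rewrite mulrBr.
  by rewrite !E//; ring.
have [Bp Bp0 Hp] := continuous_bounded_itv psi (2 * T) psi_cont.
have [Bc Bc0 Hc] := continuous_bounded_itv chi (2 * T) chi_cont.
have T2 : 0 <= 2 * T by rewrite mulr_ge0// ltW.
have W0 : 0 <= `|Wr^-1| by [].
exists ((Bc * (2 * T) / c * Bc + Bc * (Bp * (2 * T)) + Bp * (Bc * (2 * T))) * `|Wr^-1|).
  have T00 : 0 <= T := ltW T0.
  have ci : 0 <= c^-1 by rewrite invr_ge0 ltW.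
  by rewrite mulr_ge0// !addr_ge0// !mulr_ge0.
move=> f M ef fM x; have M0 : 0 <= M by apply: le_trans (fM 0).
(* The factor [chi] drifts from period to period; the estimate is made near 0 and carried over by
   periodicity of the whole solution. *)
have [k [y [yT ->]]] := periodic_reduce _ T0 x.
rewrite periodic_int; last by have [[]] := Lplus_solution_even_periodic _ ef.
have {}yT : `|y| <= 2 * T.
  by rewrite ler_norml; have /andP[? ?] := yT; have ? := T0; apply/andP; split; lra.
have E h B (Bh0 : 0 <= B) (ch : continuous (fun x => h x * f x))
    (hB : forall x, `|x| <= 2 * T -> `|h x| <= B) z : `|z| <= 2 * T ->
    `|prim (fun x => h x * f x) z| <= B * (2 * T) * M.
  move=> zT; apply: le_trans (prim_bound _ (B * M) _ ch _) _.
    by move=> t tz; rewrite normrM ler_pM// hB// (le_trans tz).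
  by rewrite mulrAC ler_wpM2r// ler_wpM2l.
have EP := E _ _ Bp0 (cpsi _ ef) Hp; have EQ := E _ _ Bc0 (cchi _ ef) Hc.
have T2' : `|2 * T| <= 2 * T by rewrite ger0_norm.
rewrite /Lplus_solution normrM [leRHS]mulrAC ler_wpM2r//.
rewrite [leRHS]mulrDl [X in _ <= X + _]mulrDl; apply: le_trans (ler_normB _ _) _; apply: lerD.
  apply: le_trans (ler_normD _ _) _; apply: lerD.
    rewrite normrM (_ : _ * _ * M = (Bc * (2 * T) * M / c) * Bc); last by ring.
    rewrite ler_pM// ?Hc// normrM normfV (gtr0_norm c_gt0) ler_wpM2r//.
      by rewrite invr_ge0 ltW.
    exact: EQ.
  by rewrite normrM -mulrA ler_pM// ?Hc// EP.
by rewrite normrM -mulrA ler_pM// ?Hp// EQ.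
Qed.

(** * Projection orthogonal to [phi] and inversion of [L-] *)

Let n2 := period_integral T (fun x => phi x * phi x).

Let T2_gt0 : 0 < 2 * T. Proof. by rewrite mulr_gt0. Qed.

Let phiM_cont f : even_periodic T f -> continuous (fun x => f x * phi x).
Proof.
by move=> ef; exact: (even_periodic_continuous _ _ (even_periodicM _ _ _ ef ep_phi)).
Qed.

Lemma norm_phi_gt0 : 0 < n2.
Proof.
rewrite /n2 /period_integral -[ltLHS](prim0 (fun x => phi x * phi x)).
apply: has_deriv_lt (prim_has_deriv _ (phiM_cont _ ep_phi)) _ T2_gt0.
by move=> z; rewrite mulr_gt0.
Qed.

Definition orth_phi f : Prop :=
  even_periodic T f /\ period_integral T (fun x => f x * phi x) = 0.

Definition phi_coeff f : R := period_integral T (fun x => f x * phi x) / n2.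

Definition proj_orth_phi f x : R := f x - phi_coeff f * phi x.

Lemma phi_coeffB f g : even_periodic T f -> even_periodic T g ->
  phi_coeff (fun x => f x - g x) = phi_coeff f - phi_coeff g.
Proof.
move=> ef eg; rewrite /phi_coeff -mulrBl -period_integralB; [|exact: phiM_cont..].
by congr (_ / _); congr period_integral; apply/funext => x; rewrite mulrBl.
Qed.

Lemma phi_coeff_bounded : exists2 C, 0 <= C & forall f M, even_periodic T f ->
  (forall x, `|f x| <= M) -> `|phi_coeff f| <= C * M.
Proof.
have [B B0 hB] := periodic_continuous_bounded _ T0 _ ep_phi.1.
exists (B * (2 * T) / n2).
  by rewrite !mulr_ge0 ?invr_ge0// ltW// norm_phi_gt0.
move=> f M ef fM.
rewrite /phi_coeff normrM normfV (gtr0_norm norm_phi_gt0) mulrAC ler_wpM2r//.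
  by rewrite invr_ge0 ltW// norm_phi_gt0.
rewrite mulrAC; apply: period_integral_bound => //; first exact: phiM_cont.
by move=> x; rewrite normrM mulrC ler_pM.
Qed.

Lemma proj_orth_phi_bounded : bounded_operator (even_periodic T) orth_phi proj_orth_phi.
Proof.
have ep f : even_periodic T f -> even_periodic T (proj_orth_phi f).
  by move=> ef; rewrite /proj_orth_phi; even_periodic.
split.
- move=> f ef; split; first exact: ep.
  rewrite /proj_orth_phi (_ : (fun x => _) =
    (fun x => f x * phi x - phi_coeff f * (phi x * phi x))); last first.
    by apply/funext => x; ring.
  rewrite period_integralB; [|exact: phiM_cont|]; last first.
    by apply: (even_periodic_continuous T); even_periodic.
  rewrite /period_integral primZ; last exact: phiM_cont.
  rewrite -!/(period_integral _ _) -/n2 /phi_coeff divfK ?subrr//.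
  by rewrite gt_eqF// norm_phi_gt0.
- move=> f g ef eg; apply/funext => x; rewrite /proj_orth_phi phi_coeffB//; ring.
have [B B0 hB] := periodic_continuous_bounded _ T0 _ ep_phi.1.
have [C C0 hC] := phi_coeff_bounded.
exists (1 + C * B); first by rewrite addr_ge0// mulr_ge0.
move=> f M ef fM x; rewrite /proj_orth_phi (le_trans (ler_normB _ _))//.
rewrite mulrDl mul1r lerD// normrM mulrAC ler_pM// hC//.
Qed.

(** With [u = phi z] and [L- phi = 0], the equation [L- u = f] becomes [(phi^2 z')' = - f phi],
    which is integrated twice from 0. *)
Definition Lminus_pre f x : R :=
  - (phi x * prim (fun y => prim (fun z => f z * phi z) y / phi y ^+ 2) x).

Let phiV_ep : even_periodic T (fun x => (phi x ^+ 2)^-1).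
Proof.
split; first split.
- apply: (has_deriv_continuous _ (fun x => - (phi x ^+ 2) ^- 2 * (2 * phi x * psi x))).
  apply: has_derivV; first by move=> x; rewrite expf_neq0.
  by apply: has_deriv_eq; [deriv|move=> x].
- by move=> x; rewrite phi_periodic.
- by move=> x; rewrite phi_even.
Qed.

Lemma Lminus_pre_deriv f : even_periodic T f -> exists u1, has_deriv (Lminus_pre f) u1 /\
  has_deriv u1 (fun x => (1 - 2 * phi x ^+ 2) * Lminus_pre f x - f x).
Proof.
move=> ef; have g_deriv := prim_has_deriv _ (phiM_cont _ ef).
have gc := has_deriv_continuous _ _ g_deriv.
set g := prim _ in g_deriv gc.
have gVc : continuous (fun y => g y / phi y ^+ 2).
  by move=> x; apply: cvgM; [exact: gc|exact: (even_periodic_continuous _ _ phiV_ep)].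
have z_deriv := prim_has_deriv _ gVc.
have V_deriv := has_derivV _ _ phi_neq0 phi_deriv.
rewrite /Lminus_pre -/g; set z := prim _ in z_deriv *.
exists (fun x => - (psi x * z x + g x * (phi x)^-1)); split.
  apply: has_deriv_eq; first by deriv.
  by move=> x /=; field.
apply: has_deriv_eq; first by deriv.
by move=> x /=; field.
Qed.

(** Orthogonality of [f] to [phi] makes the inner primitive periodic. It is also odd, so its
    quotient by [phi^2] has zero mean and the outer primitive is periodic too. *)
Lemma Lminus_pre_bounded : bounded_operator orth_phi (even_periodic T) Lminus_pre.
Proof.
have gc f : even_periodic T f -> continuous (prim (fun z => f z * phi z)).
  by move=> ef; apply: prim_continuous; exact: phiM_cont.
have hc f : even_periodic T f ->
    continuous (fun y => prim (fun z => f z * phi z) y / phi y ^+ 2).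
  move=> ef x; apply: cvgM; first exact: gc.
  exact: (even_periodic_continuous _ _ phiV_ep).
have ep f : orth_phi f -> even_periodic T (Lminus_pre f).
  move=> [ef f0]; have [u1 [uu1 _]] := Lminus_pre_deriv _ ef.
  have g_odd x : prim (fun z => f z * phi z) (- x) = - prim (fun z => f z * phi z) x.
    by apply: prim_odd; [exact: phiM_cont|move=> y; rewrite ef.2 phi_even].
  have h_odd x : prim (fun z => f z * phi z) (- x) / phi (- x) ^+ 2 =
      - (prim (fun z => f z * phi z) x / phi x ^+ 2).
    by rewrite g_odd phi_even mulNr.
  have h_pc : periodic_continuous T (fun y => prim (fun z => f z * phi z) y / phi y ^+ 2).
    split; first exact: hc.
    move=> x; rewrite phi_periodic prim_shift ?f0 ?addr0//.
    by case: (even_periodicM _ _ _ ef ep_phi).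
  split; first split.
  - exact: has_deriv_continuous uu1.
  - by move=> x; rewrite /Lminus_pre phi_periodic prim_shift// period_integral_odd// addr0.
  - by move=> x; rewrite /Lminus_pre phi_even prim_even//; exact: hc.
split => //.
- move=> f g [ef _] [eg _]; apply/funext => x; rewrite /Lminus_pre.
  have -> : (fun y => prim (fun z => (f z - g z) * phi z) y / phi y ^+ 2) =
    (fun y => prim (fun z => f z * phi z) y / phi y ^+ 2
       - prim (fun z => g z * phi z) y / phi y ^+ 2).
    apply/funext => y; rewrite -mulrBl -primB; [|exact: phiM_cont..].
    by congr (prim _ _ / _); apply/funext => z; rewrite mulrBl.
  by rewrite primB; [rewrite mulrBr opprD|exact: hc..].
have [B B0 hB] := periodic_continuous_bounded _ T0 _ ep_phi.1.
have [B' B'0 hB'] := periodic_continuous_bounded _ T0 _ phiV_ep.1.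
have T2 : 0 <= 2 * T := ltW T2_gt0.
exists (B * ((B * (2 * T)) * B' * (2 * T))); first by rewrite !mulr_ge0// ltW.
move=> f M ef fM x.
have [k [y [yT ->]]] := periodic_reduce _ T0 x.
rewrite periodic_int; last by have [[]] := ep _ ef.
have {}yT : `|y| <= 2 * T.
  by rewrite ler_norml; have /andP[? ?] := yT; have ? := T0; apply/andP; split; lra.
have M0 : 0 <= M by apply: le_trans (fM 0).
rewrite /Lminus_pre normrN normrM -mulrA ler_pM//.
have H1 t : `|t| <= 2 * T -> `|prim (fun z => f z * phi z) t| <= B * (2 * T) * M.
  move=> tT; apply: le_trans (prim_bound _ (B * M) _ (phiM_cont _ ef.1) _) _.
    by move=> s _; rewrite normrM mulrC ler_pM.
  by rewrite mulrAC ler_wpM2r// ler_wpM2l.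
apply: le_trans (prim_bound _ (B * (2 * T) * M * B') _ (hc _ ef.1) _) _.
  by move=> t ty; rewrite normrM ler_pM// H1// (le_trans ty).
rewrite [leRHS](_ : _ = B * (2 * T) * M * B' * (2 * T)); last by ring.
by rewrite ler_wpM2l// !mulr_ge0// ltW.
Qed.

(** The inner projection makes the operator total on even periodic functions, as the iteration
    requires: [M] is orthogonal to [phi] only at the fixed point. The outer one normalizes the
    solution without changing [L-] of it. *)
Definition Lminus_solution f : R -> R :=
  proj_orth_phi (Lminus_pre (proj_orth_phi f)).

Lemma Lminus_solution_bounded :
  bounded_operator (even_periodic T) orth_phi Lminus_solution.
Proof.
apply: bounded_operator_comp (bounded_operator_comp _ _ _ _ _
  proj_orth_phi_bounded Lminus_pre_bounded) proj_orth_phi_bounded.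
Qed.

Lemma Lminus_solution_deriv f : orth_phi f -> exists u1,
  has_deriv (Lminus_solution f) u1 /\
  has_deriv u1 (fun x => (1 - 2 * phi x ^+ 2) * Lminus_solution f x - f x).
Proof.
move=> [ef f0]; have projf : proj_orth_phi f = f.
  by apply/funext => x; rewrite /proj_orth_phi /phi_coeff f0 mul0r mul0r subr0.
rewrite /Lminus_solution projf; have [u1 [uu1 u12]] := Lminus_pre_deriv _ ef.
rewrite /proj_orth_phi; set k := phi_coeff _.
exists (fun x => u1 x - k * psi x); split; (apply: has_deriv_eq; first by deriv).
  by move=> x /=; ring.
by move=> x /=; ring.
Qed.

End Linearized.

(** * Uniform contractions *)

Section UniformFixedPoint.
Context {R : realType} (I : Type).
Implicit Types (f g : I -> R) (P : (I -> R) -> Prop).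

Definition uniform_limit_closed P : Prop := forall (u : nat -> I -> R) f,
  (forall n, P (u n)) ->
  (forall eps, 0 < eps -> exists n, forall i, `|u n i - f i| <= eps) -> P f.

(** The contraction principle for the sup distance, phrased through pointwise bounds [d]. *)
Lemma uniform_fixed_point P (Phi : (I -> R) -> I -> R) f0 D :
  uniform_limit_closed P -> (forall f, P f -> P (Phi f)) ->
  (forall f g d, P f -> P g -> (forall i, `|f i - g i| <= d) ->
     forall i, `|Phi f i - Phi g i| <= d / 2) ->
  P f0 -> (forall i, `|f0 i - Phi f0 i| <= D) ->
  exists2 f, P f & Phi f = f.
Proof.
move=> Pcl PPhi contr P0 hD.
pose u n := iter n Phi f0.
have Pu n : P (u n) by elim: n => //= n; exact: PPhi.
pose b n : R := D / 2 ^+ n.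
have u1 n : forall i, `|u n i - u n.+1 i| <= b n.
  elim: n => [|n IH] i; first by rewrite /b expr0 divr1; exact: hD.
  rewrite /b exprSr invfM mulrA.
  by apply: contr => //; exact: PPhi.
have bS n : b n = 2 * b n.+1.
  have n0 : (2 : R) ^+ n != 0 by rewrite expf_neq0// pnatr_eq0.
  by rewrite /b exprS; set t := _ ^+ n in n0 *; field.
(* Successive iterates differ by at most [b n], and [2 * b n] is the geometric tail; so the two
   envelopes are monotone, and the supremum of the lower one is the limit. *)
have lo i : nondecreasing_seq (fun n => u n i - 2 * b n).
  apply/nondecreasing_seqP => n.
  by have := u1 n i; rewrite ler_norml bS => /andP[? ?]; lra.
have up i : nonincreasing_seq (fun n => u n i + 2 * b n).
  apply/nonincreasing_seqP => n.
  by have := u1 n i; rewrite ler_norml bS => /andP[? ?]; lra.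
have b0 (i : I) n : 0 <= b n by apply: le_trans (u1 n i).
pose A i := range (fun n => u n i - 2 * b n).
have lu i n m : u n i - 2 * b n <= u m i + 2 * b m.
  have H k : u k i - 2 * b k <= u k i + 2 * b k by have := b0 i k; lra.
  apply: le_trans (lo i _ _ (leq_maxl n m)) _.
  by apply: le_trans (H _) (up i _ _ (leq_maxr n m)).
pose f i := sup (A i).
have An i : A i !=set0 by exists (u 0%N i - 2 * b 0%N); exists 0%N.
have uf n i : `|u n i - f i| <= 2 * b n.
  have Aub : ubound (A i) (u n i + 2 * b n) by move=> _ [m _ <-]; exact: lu.
  have h1 : f i <= u n i + 2 * b n by exact: ge_sup.
  have h2 : u n i - 2 * b n <= f i.
    by apply: ub_le_sup; [exists (u n i + 2 * b n)|exists n].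
  by rewrite ler_norml; apply/andP; split; lra.
have small eps : 0 < eps -> exists n, 2 * b n <= eps.
  move=> e0; pose q := 2 * D / eps; exists (Num.truncn q).+1.
  have : q < (Num.truncn q).+1%:R := truncnS_gt q.
  move: (Num.truncn q).+1 => n qn.
  rewrite /b mulrA ler_pdivrMr ?exprn_gt0// [leRHS]mulrC -ler_pdivrMr// -/q.
  by apply: le_trans (ltW qn) _; rewrite -natrX ler_nat; apply/ltnW/ltn_expl.
have Pf : P f.
  apply: Pcl Pu _ => eps /small[n nE]; exists n => i.
  exact: le_trans (uf n i) nE.
exists f => //; apply/funext => i; apply/eqP; rewrite -subr_eq0 -normr_eq0.
rewrite eq_le normr_ge0 andbT; apply/ler_addgt0Pl => eps /small[n nE].
rewrite addr0; have := contr _ _ _ (Pu n) Pf (uf n) i.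
have := uf n.+1 i; rewrite -[Phi (u n)]/(u n.+1); move: nE; rewrite bS => nE.
rewrite !ler_norml => /andP[? ?] /andP[? ?]; apply/andP; split; lra.
Qed.

End UniformFixedPoint.

(** * Nonlinear maps with estimates uniform in the parameter *)

Section BoundedLipschitz.
Context {R : realType} (T B : R).
Hypothesis T0 : 0 < T.

(* A pair [(v, w)] of functions is encoded as one function on [bool * R], so
   that its uniform norm is a single supremum. *)
Implicit Types (X Y : bool * R -> R) (F G : R -> (bool * R -> R) -> R -> R).

Definition even_periodic_ball X : Prop :=
  [/\ even_periodic T (fun x => X (true, x)), even_periodic T (fun x => X (false, x))
    & forall i, `|X i| <= B].

Lemma continuous_uniform_limit (f : R -> R) :
  (forall eps, 0 < eps -> exists g : R -> R,
     continuous g /\ forall x, `|g x - f x| <= eps) -> continuous f.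
Proof.
move=> H x; apply/cvgrPdist_le => eps e0.
have e3 : 0 < eps / 3 by rewrite divr_gt0.
have [g [cg gf]] := H _ e3.
have := cg x; move/cvgrPdist_le => /(_ _ e3); apply: filterS => y.
have := gf x; have := gf y; rewrite !ler_norml => /andP[? ?] /andP[? ?] /andP[? ?].
by apply/andP; split; lra.
Qed.

Lemma eq_of_le_eps (x y : R) : (forall eps, 0 < eps -> `|x - y| <= eps) -> x = y.
Proof.
move=> H; apply/eqP; rewrite -subr_eq0 -normr_eq0 eq_le normr_ge0 andbT.
by apply/ler_addgt0Pl => eps e0; rewrite addr0 H.
Qed.

Lemma even_periodic_uniform_limit (f : R -> R) :
  (forall eps, 0 < eps -> exists g : R -> R,
     even_periodic T g /\ forall x, `|g x - f x| <= eps) -> even_periodic T f.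
Proof.
move=> H.
(* Periodicity and evenness are equalities between two values, and these survive uniform limits. *)
have E (s t : R) : (forall g, even_periodic T g -> g s = g t) -> f s = f t.
  move=> gst; apply: eq_of_le_eps => eps e0.
  have e2 : 0 < eps / 2 by rewrite divr_gt0.
  have [g [eg gf]] := H _ e2.
  have := gf s; have := gf t; rewrite (gst _ eg).
  rewrite !ler_norml => /andP[? ?] /andP[? ?]; apply/andP; split; lra.
split; first split.
- apply: continuous_uniform_limit => eps /H[g [eg gf]].
  by exists g; split => //; exact: even_periodic_continuous eg.
- by move=> x; apply: E => g -[[_ pg] _]; exact: pg.
- by move=> x; apply: E => g -[_]; exact.
Qed.

Lemma even_periodic_ball_closed : uniform_limit_closed _ even_periodic_ball.
Proof.
move=> u f Pu H; split.
- apply: even_periodic_uniform_limit => eps /H[n Hn].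
  by exists (fun x => u n (true, x)); split => //; have [] := Pu n.
- apply: even_periodic_uniform_limit => eps /H[n Hn].
  by exists (fun x => u n (false, x)); split => //; have [] := Pu n.
- move=> i; apply/ler_addgt0Pl => eps /H[n Hn]; have [_ _ /(_ i)] := Pu n.
  have := Hn i; rewrite !ler_norml => /andP[? ?] /andP[? ?]; apply/andP; split; lra.
Qed.

(** The constant is uniform in [h] and serves both as a bound and as a Lipschitz constant. This
    makes the class closed under sums, products and bounded operators, so the nonlinear terms are
    estimated by following their syntax. *)
Definition bounded_lipschitz F : Prop := exists2 C, 0 <= C &
  forall h X, 0 < h < 1 -> even_periodic_ball X ->
  [/\ even_periodic T (F h X), forall x, `|F h X x| <= C &
      forall Y d, even_periodic_ball Y -> (forall i, `|X i - Y i| <= d) ->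
        forall x, `|F h X x - F h Y x| <= C * d].

Lemma bounded_lipschitz_cst f : even_periodic T f -> bounded_lipschitz (fun _ _ => f).
Proof.
move=> ef; have [M M0 fM] := periodic_continuous_bounded _ T0 _ ef.1.
exists M => // h X _ _; split => // Y d _ /(_ (true, 0)) Xd x.
by rewrite subrr normr0 mulr_ge0// (le_trans _ Xd).
Qed.

Lemma bounded_lipschitz_param : bounded_lipschitz (fun h _ _ => h).
Proof.
exists 1 => // h X /andP[h0 h1] _; split.
- exact: even_periodic_cst.
- by move=> x; rewrite gtr0_norm// ltW.
- move=> Y d _ /(_ (true, 0)) Xd x.
  by rewrite subrr normr0 mulr_ge0// (le_trans _ Xd).
Qed.

Hypothesis B0 : 0 <= B.

Lemma bounded_lipschitz_coord b : bounded_lipschitz (fun _ X x => X (b, x)).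
Proof.
exists (B + 1); first by rewrite addr_ge0.
move=> h X _ [e1 e2 XB]; split.
- by case: b.
- by move=> x; rewrite (le_trans (XB _))// lerDl.
- move=> Y d _ Xd x; have d0 : 0 <= d by apply: le_trans (Xd (true, 0)).
  by rewrite (le_trans (Xd _))// ler_peMl// lerDr.
Qed.

Lemma bounded_lipschitzD F G : bounded_lipschitz F -> bounded_lipschitz G ->
  bounded_lipschitz (fun h X x => F h X x + G h X x).
Proof.
move=> [C C0 HF] [C' C'0 HG]; exists (C + C'); first exact: addr_ge0.
move=> h X h01 BX; have [e1 b1 l1] := HF _ _ h01 BX; have [e2 b2 l2] := HG _ _ h01 BX.
split.
- exact: even_periodicD.
- by move=> x; rewrite (le_trans (ler_normD _ _))// lerD.
- move=> Y d BY Xd x; rewrite opprD addrACA mulrDl.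
  by rewrite (le_trans (ler_normD _ _))// lerD// ?l1// l2.
Qed.

Lemma bounded_lipschitzM F G : bounded_lipschitz F -> bounded_lipschitz G ->
  bounded_lipschitz (fun h X x => F h X x * G h X x).
Proof.
move=> [C C0 HF] [C' C'0 HG]; exists (C * C' + C * C'); first by rewrite addr_ge0// mulr_ge0.
move=> h X h01 BX; have [e1 b1 l1] := HF _ _ h01 BX; have [e2 b2 l2] := HG _ _ h01 BX.
split.
- exact: even_periodicM.
- by move=> x; rewrite normrM (le_trans (ler_pM _ _ (b1 x) (b2 x)))// lerDl mulr_ge0.
- move=> Y d BY Xd x; have [_ b3 _] := HG _ _ h01 BY.
  have d0 : 0 <= d by apply: le_trans (Xd (true, 0)).
  rewrite (_ : _ - _ = F h X x * (G h X x - G h Y x) + (F h X x - F h Y x) * G h Y x).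
    rewrite (le_trans (ler_normD _ _))// !normrM mulrDl lerD//.
      by rewrite -mulrA ler_pM// l2.
    by rewrite mulrAC ler_pM// l1.
  by ring.
Qed.

Lemma bounded_lipschitzX F n : bounded_lipschitz F ->
  bounded_lipschitz (fun h X x => F h X x ^+ n).
Proof.
move=> lF; elim: n => [|n IH].
  exact: (bounded_lipschitz_cst _ (even_periodic_cst _ 1)).
rewrite (_ : (fun _ _ _ => _) = fun h X x => F h X x * F h X x ^+ n).
  exact: bounded_lipschitzM.
by apply/funext => h; apply/funext => X; apply/funext => x; rewrite exprS.
Qed.

Lemma bounded_lipschitz_op S' K F : bounded_operator (even_periodic T) S' K ->
  (forall f, S' f -> even_periodic T f) -> bounded_lipschitz F ->
  bounded_lipschitz (fun h X => K (F h X)).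
Proof.
move=> [KS KB [C C0 HK]] S'e [C' C'0 HF]; exists (C * C'); first exact: mulr_ge0.
move=> h X h01 BX; have [e1 b1 l1] := HF _ _ h01 BX; split.
- exact/S'e/KS.
- by move=> x; apply: HK.
- move=> Y d BY Xd x; have [e2 _ _] := HF _ _ h01 BY.
  rewrite -mulrA -[X in `|X|]/((fun x => K (F h X) x - K (F h Y) x) x) -KB//.
  apply: HK; last by move=> y; exact: l1.
  by apply: even_periodicD => //; exact: even_periodicN.
Qed.

End BoundedLipschitz.

(** * Lyapunov-Schmidt reduction *)

Section PeriodIntegralLinear.
Context {R : realType} (T : R).
Implicit Types f g : R -> R.

Lemma period_integralZ c f : even_periodic T f ->
  period_integral T (fun x => c * f x) = c * period_integral T f.
Proof. by move=> ef; apply: primZ; exact: even_periodic_continuous ef. Qed.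

Lemma period_integralD f g : even_periodic T f -> even_periodic T g ->
  period_integral T (fun x => f x + g x) = period_integral T f + period_integral T g.
Proof.
move=> ef eg; rewrite (_ : (fun x => _) = fun x => f x - (-1) * g x).
  rewrite period_integralB ?period_integralZ ?mulN1r ?opprK//.
    exact: even_periodic_continuous ef.
  by apply: (even_periodic_continuous T); even_periodic.
by apply/funext => x; rewrite mulN1r opprK.
Qed.

End PeriodIntegralLinear.

Ltac bounded_lipschitz := lazymatch goal with
  | |- bounded_lipschitz _ _ (fun h X x => @?F h X x + @?G h X x) =>
      eapply bounded_lipschitzD; bounded_lipschitz
  | |- bounded_lipschitz _ _ (fun h X x => @?F h X x ^+ ?n) =>
      eapply bounded_lipschitzX; [assumption | bounded_lipschitz]
  | |- bounded_lipschitz _ _ (fun h X x => @?F h X x * @?G h X x) =>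
      eapply bounded_lipschitzM; bounded_lipschitz
  | |- _ => first [ assumption | exact: bounded_lipschitz_param
      | apply: bounded_lipschitz_coord; assumption
      | apply: bounded_lipschitz_cst; [assumption | even_periodic] ]
  end.

Lemma bigO_sqr {R : realType} (c : R -> R) (C h0 : R) : 0 < h0 ->
  (forall h, 0 < h < h0 -> `|c h| <= C * h ^+ 2) ->
  c =O_ (0^'+) (fun h => h ^+ 2).
Proof.
move=> h00 cC; apply/eqOP; exists C; split; first exact: num_real.
move=> K CK; near=> h.
have hh : 0 < h < h0.
  by apply/andP; split; near: h; [exact: nbhs_right_gt|exact: nbhs_right_lt].
rewrite (le_trans (cC _ hh))// (ger0_norm (sqr_ge0 h)) ler_wpM2r ?sqr_ge0//.
exact: ltW.
Unshelve. all: by end_near. Qed.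

Section Bifurcation.
Context {R : realType} (T e : R) (phi psi : R -> R).
Hypothesis T0 : 0 < T.
Hypothesis e1 : 4 * e < 1.
Hypothesis phi_deriv : has_deriv phi psi.
Hypothesis psi_deriv : has_deriv psi (fun x => phi x - 2 * phi x ^+ 3).
Hypothesis energy : forall x, psi x ^+ 2 = phi x ^+ 2 - phi x ^+ 4 - e.
Hypothesis phi_gt0 : forall x, 0 < phi x.
Hypothesis phi_even : even_fun phi.
Hypothesis phi_periodic : periodic phi (2 * T).

Let m1 := period_integral T phi.
Let n2 := period_integral T (fun x => phi x * phi x).

Let ep_phi : even_periodic T phi.
Proof. by split=> //; split=> //; exact: has_deriv_continuous phi_deriv. Qed.

(** From here on the inverses enter only through their sup bounds and the equations that they solve;
    [Lm] solves its equation only for right-hand sides orthogonal to [phi]. *)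
Variables Lp Lm : (R -> R) -> R -> R.
Hypothesis Lp_bounded : bounded_operator (even_periodic T) (even_periodic T) Lp.
Hypothesis Lm_bounded : bounded_operator (even_periodic T) (orth_phi T phi) Lm.
Hypothesis Lp_deriv : forall f, even_periodic T f -> exists u1, has_deriv (Lp f) u1 /\
  has_deriv u1 (fun x => (1 - 6 * phi x ^+ 2) * Lp f x - f x).
Hypothesis Lm_deriv : forall f, orth_phi T phi f -> exists u1, has_deriv (Lm f) u1 /\
  has_deriv u1 (fun x => (1 - 2 * phi x ^+ 2) * Lm f x - f x).

Let m1_gt0 : 0 < m1.
Proof.
rewrite /m1 /period_integral -[ltLHS](prim0 phi).
apply: has_deriv_lt (prim_has_deriv _ (even_periodic_continuous _ _ ep_phi)) phi_gt0 _.
by rewrite mulr_gt0.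
Qed.

Let n2_gt0 : 0 < n2. Proof. exact: (norm_phi_gt0 _ _ psi). Qed.

Let V x := (1 - 2 * phi x ^+ 2) / (1 - 4 * e).

Let V1 x := - (4 * phi x * psi x) / (1 - 4 * e).

Let e1_neq0 : 1 - 4 * e != 0.
Proof. by rewrite subr_eq0 eq_sym lt_eqF. Qed.

Let ep_V : even_periodic T V. Proof. by rewrite /V; even_periodic. Qed.

Let V_deriv : has_deriv V V1.
Proof.
apply: has_deriv_eq; first by rewrite /V; deriv.
by move=> x; rewrite /V1 /=; field.
Qed.

Let V1_deriv : has_deriv V1 (fun x => (1 - 6 * phi x ^+ 2) * V x - 1).
Proof.
apply: has_deriv_eq; first by rewrite /V1; deriv.
move=> x; rewrite /V /=.
have E : psi x * psi x = phi x ^+ 2 - phi x ^+ 4 - e by rewrite -expr2 energy.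
rewrite mulr0 add0r mulr0 addr0 [X in _ * - X](_ : _ =
  4 * (psi x * psi x) + 4 * (phi x * (phi x - 2 * phi x ^+ 3))); last by ring.
by rewrite E; field.
Qed.

Let periodic_weight c : periodic_continuous T (fun x => 1 - c * phi x ^+ 2).
Proof. by have [] : even_periodic T (fun x => 1 - c * phi x ^+ 2) by even_periodic. Qed.

Lemma Lplus_inv1 : Lplus_inv T phi (cst 1) = V.
Proof.
have [Z1 [ZZ1 Z12]] := Lp_deriv _ ep_V.
have [LpE _ _] := Lp_bounded.
(* [Lp V] exhibits [V] as an element of the range of [L+]. *)
apply: (schrodinger_invE _ T0 _ _ _ V1 (Lp V) Z1) => //.
- exact: periodic_continuous_cst.
- by case: ep_V => -[].
- by case: (LpE _ ep_V) => -[].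
Qed.

Lemma Lminus_invE f : orth_phi T phi f -> Lminus_inv T phi f = Lm f.
Proof.
move=> of_; have [u1 [uu1 u12]] := Lm_deriv _ of_.
have [LmE _ _] := Lm_bounded.
have oLm := LmE _ of_.1; have [Z1 [ZZ1 Z12]] := Lm_deriv _ oLm.
apply: (schrodinger_invE _ T0 _ _ _ u1 (Lm (Lm f)) Z1) => //.
- by case: of_.1.
- by case: oLm => -[[]].
- by case: (LmE _ oLm.1) => -[[]].
Qed.

(** By the wave equation, [(1 - 2 phi^2) phi] is the derivative of the periodic function [psi]. *)
Let V_phi : period_integral T (fun x => V x * phi x) = 0.
Proof.
apply: (period_integral_deriv _ (fun x => psi x / (1 - 4 * e))).
- by apply: (even_periodic_continuous T); even_periodic.
- apply: has_deriv_eq; first by deriv.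
  by move=> x; rewrite /V /=; field.
- by move=> x; rewrite (has_deriv_periodic _ _ _ phi_deriv phi_periodic).
Qed.

(** Symmetry of [L+] applied to [L+ phi = - 4 phi^3] and [L+ V = 1]. *)
Let phi3_V : period_integral T (fun x => phi x ^+ 3 * V x) = - (m1 / 4).
Proof.
have H : period_integral T (fun x => -4 * phi x ^+ 3 * V x) =
    period_integral T (fun x => phi x * 1).
  apply: (schrodinger_symmetric _ (fun x => 1 - 6 * phi x ^+ 2) phi psi _ V V1 (fun=> 1)) => //.
  - by have [] : even_periodic T (fun x => -4 * phi x ^+ 3) by even_periodic.
  - exact: periodic_continuous_cst.
  - by apply: has_deriv_eq psi_deriv _ => x; ring.
  - by case: ep_V => -[].
move: H; rewrite (_ : (fun x => -4 * _ * _) = fun x => -4 * (phi x ^+ 3 * V x)).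
  rewrite period_integralZ; last by even_periodic.
  rewrite (_ : (fun x => phi x * 1) = phi); last by apply/funext => x; rewrite mulr1.
  by rewrite -/m1; lra.
by apply/funext => x; rewrite /=; ring.
Qed.

Section Amplitudes.
Variables (alpha0 a0 b0 : R).
Hypothesis ab1 : a0 ^+ 2 + b0 ^+ 2 = 1.
Hypothesis a0_neq0 : a0 != 0.
Hypothesis b0E : b0 * m1 = alpha0 * n2.

Let W := Lm (fun x => b0 - alpha0 * phi x).

(** This is the first-order solvability condition; [b0E] expresses it as the choice of phase. *)
Lemma Lminus_rhs_orth : orth_phi T phi (fun x => b0 - alpha0 * phi x).
Proof.
split; first by even_periodic.
rewrite (_ : (fun x => _) = fun x => b0 * phi x + - alpha0 * (phi x * phi x)).
  rewrite period_integralD; [|even_periodic..].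
  by rewrite !period_integralZ ?b0E -/n2; [ring|even_periodic..].
by apply/funext => x; ring.
Qed.

Let W_orth : orth_phi T phi W.
Proof. by have [LmE _ _] := Lm_bounded; exact: LmE Lminus_rhs_orth.1. Qed.

Let ep_W : even_periodic T W. Proof. by case: W_orth. Qed.

Let D := 8 * (period_integral T (fun x => phi x ^+ 2 * V x * W x) / m1).

(** [X (true, x)] stands for [v] and [X (false, x)] for [w]. [N] and [M] are the real and imaginary
    parts of what remains, divided by [h^2], after the equation is divided by [a0 + i b0] and its
    terms of order 0 and 1 in [h] are split off. *)
Let N (h : R) (X : bool * R -> R) (x : R) : R :=
  - alpha0 * X (false, x) + 6 * phi x * X (true, x) ^+ 2
  + 2 * phi x * X (false, x) ^+ 2
  + 2 * h * (X (true, x) ^+ 3 + X (false, x) ^+ 2 * X (true, x)).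

Let M (h : R) (X : bool * R -> R) (x : R) : R :=
  4 * phi x * X (true, x) * X (false, x)
  + 2 * h * ((X (true, x) ^+ 2 + X (false, x) ^+ 2) * X (false, x))
  + alpha0 * X (true, x).

Let v1 h X := Lp (N h X).
Let w1 h X := Lm (M h X).

(** The terms of [M phi] that carry a factor [h] once [v] and [w] are decomposed, divided by [h] and
    without the term in [G] itself. *)
Let Gi (h : R) (X : bool * R -> R) (x : R) : R :=
  4 * a0 * phi x ^+ 2 * V x * w1 h X x + 4 * phi x ^+ 2 * v1 h X x * X (false, x)
  + 2 * (X (true, x) ^+ 2 + X (false, x) ^+ 2) * X (false, x) * phi x
  + alpha0 * v1 h X x * phi x.

Let G h X : R := (a0 * m1)^-1 * period_integral T (Gi h X).

Section Lipschitz.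
Variable B : R.
Hypothesis B0 : 0 <= B.

Let v1_lip : bounded_lipschitz T B v1.
Proof.
apply: (bounded_lipschitz_op _ _ _ _ _ Lp_bounded) => //.
by rewrite /N; bounded_lipschitz.
Qed.

Let w1_lip : bounded_lipschitz T B w1.
Proof.
apply: (bounded_lipschitz_op _ _ _ _ _ Lm_bounded); first by move=> f [].
by rewrite /M; bounded_lipschitz.
Qed.

Let G_lip : bounded_lipschitz T B (fun h X _ => G h X).
Proof.
have H : bounded_lipschitz T B Gi.
  have v1_lip' : bounded_lipschitz T B (fun h X x => v1 h X x) := v1_lip.
  have w1_lip' : bounded_lipschitz T B (fun h X x => w1 h X x) := w1_lip.
  by rewrite /Gi; bounded_lipschitz.
have I_lip := bounded_lipschitz_op _ _ _ _ _ (bounded_operator_integral _ T0) (fun _ => id) H.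
rewrite /G; apply: bounded_lipschitzM => //.
by apply: bounded_lipschitz_cst => //; even_periodic.
Qed.

Lemma correction_bounds : exists2 C, 0 <= C & forall h X, 0 < h < 1 ->
  even_periodic_ball T B X ->
  [/\ even_periodic T (v1 h X), even_periodic T (w1 h X),
      forall x, `|v1 h X x| <= C, forall x, `|w1 h X x| <= C &
      `|G h X| <= C] /\
  forall Y d, even_periodic_ball T B Y -> (forall i, `|X i - Y i| <= d) ->
    [/\ forall x, `|v1 h X x - v1 h Y x| <= C * d,
        forall x, `|w1 h X x - w1 h Y x| <= C * d & `|G h X - G h Y| <= C * d].
Proof.
have [C1 C10 H1] := v1_lip; have [C2 C20 H2] := w1_lip; have [C3 C30 H3] := G_lip.
exists (C1 + C2 + C3); first by rewrite !addr_ge0.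
have le1 : C1 <= C1 + C2 + C3 by lra.
have le2 : C2 <= C1 + C2 + C3 by lra.
have le3 : C3 <= C1 + C2 + C3 by lra.
move=> h X h01 BX; have [e_1 b_1 l_1] := H1 _ _ h01 BX.
have [e_2 b_2 l_2] := H2 _ _ h01 BX; have [e_3 b_3 l_3] := H3 _ _ h01 BX.
split; first split => //.
- by move=> x; exact: le_trans (b_1 x) le1.
- by move=> x; exact: le_trans (b_2 x) le2.
- exact: le_trans (b_3 0) le3.
move=> Y d BY Xd; have d0 : 0 <= d by apply: le_trans (Xd (true, 0)).
split.
- by move=> x; apply: le_trans (l_1 _ _ BY Xd x) _; rewrite ler_wpM2r.
- by move=> x; apply: le_trans (l_2 _ _ BY Xd x) _; rewrite ler_wpM2r.
- by apply: le_trans (l_3 _ _ BY Xd 0) _; rewrite ler_wpM2r.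
Qed.

End Lipschitz.

Let Phi h X (i : bool * R) : R :=
  if i.1 then a0 * V i.2 + h * v1 h X i.2
  else - W i.2 - D / 2 * phi i.2 + h * (w1 h X i.2 + G h X * phi i.2).

Lemma bifurcation_fixed_point : exists C h0, [/\ 0 < h0, h0 < 1, 0 <= C &
  forall h, 0 < h < h0 -> exists X, [/\ Phi h X = X,
    even_periodic T (fun x => X (true, x)), even_periodic T (fun x => X (false, x)),
    even_periodic T (v1 h X) /\ even_periodic T (w1 h X) &
    [/\ forall x, `|v1 h X x| <= C, forall x, `|w1 h X x| <= C & `|G h X| <= C]]].
Proof.
(* The value of [Phi] at [h = 0], which starts the iteration. *)
pose X0 (i : bool * R) := if i.1 then a0 * V i.2 else - W i.2 - D / 2 * phi i.2.
have e_1 : even_periodic T (fun x => X0 (true, x)) by rewrite /X0 /=; even_periodic.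
have e_2 : even_periodic T (fun x => X0 (false, x)) by rewrite /X0 /=; even_periodic.
have [B1 B10 hB1] := periodic_continuous_bounded _ T0 _ e_1.1.
have [B2 B20 hB2] := periodic_continuous_bounded _ T0 _ e_2.1.
have [B3 B30 hB3] := periodic_continuous_bounded _ T0 _ ep_phi.1.
(* The extra 1 leaves room around [X0] for the correction, of size at most [h * C' < 1 / 2]. *)
pose B := B1 + B2 + 1.
have B0 : 0 <= B by rewrite /B !addr_ge0.
have [C C0 HC] := correction_bounds _ B0.
pose C' := C + C + C * B3.
have C'0 : 0 <= C' by rewrite /C' !addr_ge0// mulr_ge0.
have X0B i : `|X0 i| <= B1 + B2.
  case: i => -[] x; first by rewrite (le_trans (hB1 x))// lerDl.
  by rewrite (le_trans (hB2 x))// lerDr.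
(* This bound on [h] makes [h * C'], the Lipschitz constant of [Phi], less than one half, and also
   keeps [h < 1]. *)
exists C, (2 * (C' + 1))^-1; have C2 : 0 < 2 * (C' + 1) by lra.
split => //; first by rewrite invr_gt0.
  by rewrite invf_lt1//; lra.
move=> h /andP[h0 hC].
have h2 : h * (C' + 1) < 1 / 2.
  by move: hC; rewrite -[X in _ < X]mul1r ltr_pdivlMr//; lra.
have hC' : h * C' < 1 / 2 by move: h2; rewrite mulrDr mulr1; lra.
have h1 : h < 1 / 2.
  by have := mulr_ge0 (ltW h0) C'0; move: h2; rewrite mulrDr mulr1; lra.
have h01 : 0 < h < 1 by rewrite h0 /=; lra.
have PhiX0 X i : even_periodic_ball T B X -> `|X0 i - Phi h X i| <= h * C'.
  move=> BX; have [[ev ew bv bw bG] _] := HC _ _ h01 BX.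
  case: i => -[] x; rewrite /X0 /Phi /=.
    rewrite [X in `|X|](_ : _ = - (h * v1 h X x)); last by ring.
    rewrite normrN normrM (gtr0_norm h0) ler_pM2l// (le_trans (bv x))// /C' -addrA lerDl.
    by rewrite addr_ge0// mulr_ge0.
  rewrite [X in `|X|](_ : _ = - (h * (w1 h X x + G h X * phi x))); last by ring.
  rewrite normrN normrM (gtr0_norm h0) ler_pM2l// (le_trans (ler_normD _ _))// /C' lerD//.
    by rewrite (le_trans (bw x))// lerDl.
  by rewrite normrM ler_pM.
have [] := @uniform_fixed_point R _ (even_periodic_ball T B) (Phi h) X0 (h * C').
- exact: even_periodic_ball_closed.
- move=> X BX; have [[ev ew _ _ _] _] := HC _ _ h01 BX; split.
  + by rewrite /Phi /=; even_periodic.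
  + by rewrite /Phi /=; even_periodic.
  + move=> i; rewrite -[Phi h X i](subKr (X0 i)) (le_trans (ler_normB _ _))// /B lerD//.
    by apply: le_trans (PhiX0 _ _ BX) _; lra.
- move=> X Y d BX BY Xd i; have d0 : 0 <= d by apply: le_trans (Xd (true, 0)).
  have [_ /(_ _ _ BY Xd)[lv lw lG]] := HC _ _ h01 BX.
  apply: (@le_trans _ _ (h * (C' * d))); last first.
    by rewrite mulrA mulrC ler_wpM2l//; move: hC'; lra.
  case: i => -[] x; rewrite /Phi /=.
    rewrite [X in `|X|](_ : _ = h * (v1 h X x - v1 h Y x)); last by ring.
    rewrite normrM (gtr0_norm h0) ler_pM2l// (le_trans (lv x))//.
    by rewrite ler_wpM2r// /C' -addrA lerDl addr_ge0// mulr_ge0.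
  rewrite [X in `|X|](_ : _ = h * ((w1 h X x - w1 h Y x) + (G h X - G h Y) * phi x)).
    rewrite normrM (gtr0_norm h0) ler_pM2l// (le_trans (ler_normD _ _))//.
    rewrite /C' [leRHS]mulrDl lerD//.
      by rewrite (le_trans (lw x))// ler_wpM2r// lerDl.
    by rewrite normrM [leRHS]mulrAC ler_pM.
  by ring.
- by split => // i; rewrite (le_trans (X0B i))// /B lerDl.
- move=> i; apply: PhiX0; split => // j; rewrite (le_trans (X0B j))// /B lerDl//.
move=> X BX XE; exists X; have [[ev ew bv bw bG] _] := HC _ _ h01 BX.
by have [? ? _] := BX; split.
Qed.


(** * From a fixed point to a stationary solution *)

Section FixedPoint.
Variables (h : R) (X : bool * R -> R).
Hypothesis XE : Phi h X = X.
Hypothesis ep_v : even_periodic T (fun x => X (true, x)).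
Hypothesis ep_w : even_periodic T (fun x => X (false, x)).
Hypothesis ep_v1 : even_periodic T (v1 h X).
Hypothesis ep_w1 : even_periodic T (w1 h X).

Let v x := X (true, x).
Let w x := X (false, x).

Let vE x : v x = a0 * V x + h * v1 h X x.
Proof. by rewrite /v -[in LHS]XE. Qed.

Let wE x : w x = - W x - D / 2 * phi x + h * (w1 h X x + G h X * phi x).
Proof. by rewrite /w -[in LHS]XE. Qed.

Let ep_N : even_periodic T (N h X). Proof. by rewrite /N; even_periodic. Qed.

(* [G] was chosen so that <M, phi> is [a0 m1] times the defect in the equation
   for the coefficient of [phi] in [w], which vanishes at a fixed point. *)
Let M_orth : orth_phi T phi (M h X).
Proof.
split; first by rewrite /M; even_periodic.
have ep_Gi : even_periodic T (Gi h X) by rewrite /Gi; even_periodic.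
have m1_neq0 : m1 != 0 by rewrite gt_eqF.
pose k1 := - (4 * a0); pose k2 := 4 * a0 * (h * G h X - D / 2); pose k3 := alpha0 * a0.
rewrite (_ : (fun x => M h X x * phi x) = fun x => h * Gi h X x
    + k1 * (phi x ^+ 2 * V x * W x) + k2 * (phi x ^+ 3 * V x) + k3 * (V x * phi x)).
  rewrite !period_integralD ?period_integralZ; [|even_periodic..].
  rewrite V_phi phi3_V.
  have -> : period_integral T (Gi h X) = a0 * m1 * G h X.
    by rewrite /G mulrA mulfV ?mul1r// mulf_neq0.
  have -> : period_integral T (fun x => phi x ^+ 2 * V x * W x) = D * m1 / 8.
    by rewrite /D; field.
  by rewrite /k1 /k2 /k3; field.
apply/funext => x.
have v0 : v x - (a0 * V x + h * v1 h X x) = 0 by rewrite vE subrr.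
have w0 : w x - (- W x - D / 2 * phi x + h * (w1 h X x + G h X * phi x)) = 0.
  by rewrite wE subrr.
(* The identity holds modulo the fixed point equations [v0] and [w0]. Each is added with the
   multiplier found by substituting first for [v], then for the [w] that remains beside [a0 V]. *)
rewrite -[RHS]addr0 -[X in _ = _ + X](mulr0 (4 * phi x ^+ 2 * w x + alpha0 * phi x)) -v0.
rewrite -[RHS]addr0 -[X in _ = _ + X](mulr0 (4 * a0 * phi x ^+ 2 * V x)) -w0.
rewrite /M /Gi /k1 /k2 /k3 -/(v x) -/(w x).
by move: (G h X) (v1 h X x) (w1 h X x) (W x) (V x) D => *; ring.
Qed.

Let v_deriv : exists v', has_deriv v v' /\
  has_deriv v' (fun x => (1 - 6 * phi x ^+ 2) * v x - a0 - h * N h X x).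
Proof.
have [u1 [uu1 u12]] := Lp_deriv _ ep_N; exists (fun x => a0 * V1 x + h * u1 x); split.
  apply: (has_deriv_eql (fun x => a0 * V x + h * Lp (N h X) x)); last by move=> x; rewrite vE.
  by apply: has_deriv_eq; [deriv|move=> x /=; ring].
apply: has_deriv_eq; first by deriv.
by move=> x /=; rewrite vE /v1; ring.
Qed.

(** Here [M_orth] is used, since [Lm] solves the equation only on the orthogonal of [phi]; the
    multiple of [phi] in [w] is free because [L- phi = 0]. *)
Let w_deriv : exists w', has_deriv w w' /\
  has_deriv w' (fun x => (1 - 2 * phi x ^+ 2) * w x + b0 - alpha0 * phi x - h * M h X x).
Proof.
have [u1 [uu1 u12]] := Lm_deriv _ M_orth.
have [W1 [WW1 W12]] := Lm_deriv _ Lminus_rhs_orth.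
rewrite -/W in WW1 W12.
have wE' x : w x = - W x - D / 2 * phi x + h * (Lm (M h X) x + G h X * phi x) := wE x.
move: (G h X) D wE' => g d wE'.
exists (fun x => - W1 x - d / 2 * psi x + h * (u1 x + g * psi x)); split.
  apply: (has_deriv_eql (fun x => - W x - d / 2 * phi x + h * (Lm (M h X) x + g * phi x))).
    by apply: has_deriv_eq; [deriv|move=> x /=; ring].
  by move=> x; rewrite wE'.
apply: has_deriv_eq; first by deriv.
move=> x /=; rewrite wE'; ring.
Qed.

Definition profile1 x := a0 * phi x + h * (a0 * v x - b0 * w x).
Definition profile2 x := b0 * phi x + h * (b0 * v x + a0 * w x).

Lemma profile_stationary : stationary_solution (alpha0 * h) h profile1 profile2.
Proof.
have [v' [vv' v'']] := v_deriv; have [w' [ww' w'']] := w_deriv.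
have d1 : has_deriv profile1 (fun x => a0 * psi x + h * (a0 * v' x - b0 * w' x)).
  by apply: has_deriv_eq; [rewrite /profile1; deriv|move=> x /=; ring].
have d2 : has_deriv profile2 (fun x => b0 * psi x + h * (b0 * v' x + a0 * w' x)).
  by apply: has_deriv_eq; [rewrite /profile2; deriv|move=> x /=; ring].
pose v2 x := (1 - 6 * phi x ^+ 2) * v x - a0 - h * N h X x.
pose w2 x := (1 - 2 * phi x ^+ 2) * w x + b0 - alpha0 * phi x - h * M h X x.
have d12 : has_deriv (fun x => a0 * psi x + h * (a0 * v' x - b0 * w' x))
    (fun x => a0 * (phi x - 2 * phi x ^+ 3) + h * (a0 * v2 x - b0 * w2 x)).
  by apply: has_deriv_eq; [deriv|move=> x; rewrite /v2 /w2 /=; ring].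
have d22 : has_deriv (fun x => b0 * psi x + h * (b0 * v' x + a0 * w' x))
    (fun x => b0 * (phi x - 2 * phi x ^+ 3) + h * (b0 * v2 x + a0 * w2 x)).
  by apply: has_deriv_eq; [deriv|move=> x; rewrite /v2 /w2 /=; ring].
have E1 : derive1 profile1 = fun x => a0 * psi x + h * (a0 * v' x - b0 * w' x).
  by apply/funext => x; exact: has_deriv_val d1.
have E2 : derive1 profile2 = fun x => b0 * psi x + h * (b0 * v' x + a0 * w' x).
  by apply/funext => x; exact: has_deriv_val d2.
(* Multiplication by the unit number [a0 + i b0] preserves the modulus. *)
have modulus x : profile1 x ^+ 2 + profile2 x ^+ 2 = (phi x + h * v x) ^+ 2 + (h * w x) ^+ 2.
  by rewrite -[RHS]mul1r -ab1 /profile1 /profile2; ring.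
split.
- move=> x; split; first exact: has_deriv_derivable d1.
  by rewrite E1; exact: has_deriv_derivable d12.
- move=> x; split; first exact: has_deriv_derivable d2.
  by rewrite E2; exact: has_deriv_derivable d22.
- move=> x; rewrite modulus /= E1 (has_deriv_val _ _ _ d12).
  (* The forcing entered the equations for [v] and [w] rotated, as [a0] and [b0]; rotating back
     produces this sum of squares. *)
  have hE : h = h * (a0 ^+ 2 + b0 ^+ 2) by rewrite ab1 mulr1.
  rewrite [X in _ = _ - X]hE /profile1 /profile2 /v2 /w2 /N /M -/(v x) -/(w x).
  by move: (v x) (w x) => *; ring.
- move=> x; rewrite modulus /= E2 (has_deriv_val _ _ _ d22).
  rewrite /profile1 /profile2 /v2 /w2 /N /M -/(v x) -/(w x).
  by move: (v x) (w x) => *; ring.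
Qed.

Lemma profile1_even_periodic : even_periodic T profile1.
Proof. by rewrite /profile1; even_periodic. Qed.

Lemma profile2_even_periodic : even_periodic T profile2.
Proof. by rewrite /profile2; even_periodic. Qed.

(** [w1] is orthogonal to [phi] but [v1] need not be: its component along [phi] goes into the scalar
    [O(h^2)] terms, and the rest into the orthogonal remainders. *)
Let k := phi_coeff T phi (v1 h X).
Let p := proj_orth_phi T phi (v1 h X).

Lemma profile1_expansion x : profile1 x =
  (a0 + b0 / 2 * h * D + h ^+ 2 * (a0 * k - b0 * G h X)) * phi x
  + h * (a0 ^+ 2 * V x + b0 * W x) + h ^+ 2 * (a0 * p x - b0 * w1 h X x).
Proof.
rewrite /profile1 vE wE /p /proj_orth_phi -/k.
by move: (G h X) (v1 h X x) (w1 h X x) (W x) (V x) D k => *; field.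
Qed.

Lemma profile2_expansion x : profile2 x =
  (b0 - a0 / 2 * h * D + h ^+ 2 * (b0 * k + a0 * G h X)) * phi x
  + h * (a0 * b0 * V x - a0 * W x) + h ^+ 2 * (b0 * p x + a0 * w1 h X x).
Proof.
rewrite /profile2 vE wE /p /proj_orth_phi -/k.
by move: (G h X) (v1 h X x) (w1 h X x) (W x) (V x) D k => *; field.
Qed.

End FixedPoint.


Lemma orth_phiM c f : orth_phi T phi f -> orth_phi T phi (fun x => c * f x).
Proof.
move=> [ef f0]; split; first by even_periodic.
rewrite (_ : (fun x => _) = fun x => c * (f x * phi x)).
  by rewrite period_integralZ ?f0 ?mulr0//; even_periodic.
by apply/funext => x; rewrite mulrA.
Qed.

Lemma orth_phiD f g : orth_phi T phi f -> orth_phi T phi g ->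
  orth_phi T phi (fun x => f x + g x).
Proof.
move=> [ef f0] [eg g0]; split; first by even_periodic.
rewrite (_ : (fun x => _) = fun x => f x * phi x + g x * phi x).
  by rewrite period_integralD ?f0 ?g0 ?addr0//; even_periodic.
by apply/funext => x; rewrite mulrDl.
Qed.

Lemma bifurcation :
  exists h0 : R, 0 < h0 /\
  exists phi1 phi2 : R -> R -> R,
    (forall h : R, 0 < h < h0 ->
      [/\ stationary_solution (alpha0 * h) h (phi1 h) (phi2 h),
          even_fun (phi1 h), even_fun (phi2 h),
          periodic (phi1 h) (2 * T) & periodic (phi2 h) (2 * T)]) /\
    exists (c1 c2 : R -> R) (r1 r2 : R -> R -> R),
    [/\ forall h : R, 0 < h < h0 ->
          [/\ L2per T (r1 h), L2per T (r2 h),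
              inner T (r1 h) phi = 0 & inner T (r2 h) phi = 0],
        forall h : R, 0 < h < h0 -> forall x,
          phi1 h x = (a0 + b0 / 2 * h * D + c1 h) * phi x
                     + h * (a0 ^+ 2 * V x + b0 * W x) + r1 h x /\
          phi2 h x = (b0 - a0 / 2 * h * D + c2 h) * phi x
                     + h * (a0 * b0 * V x - a0 * W x) + r2 h x,
        c1 =O_ (0^'+) (fun h : R => h ^+ 2) /\
        c2 =O_ (0^'+) (fun h : R => h ^+ 2) &
        (fun h => norm2 T (r1 h)) =O_ (0^'+) (fun h : R => h ^+ 2) /\
        (fun h => norm2 T (r2 h)) =O_ (0^'+) (fun h : R => h ^+ 2)].
Proof.
have [C [h0 [h00 h01 C0 H]]] := bifurcation_fixed_point.
(* Choice needs a value for every [h]; outside the interval it is arbitrary. *)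
have /choice[X HX] : forall h, exists X, 0 < h < h0 -> [/\ Phi h X = X,
    even_periodic T (fun x => X (true, x)), even_periodic T (fun x => X (false, x)),
    even_periodic T (v1 h X) /\ even_periodic T (w1 h X) &
    [/\ forall x, `|v1 h X x| <= C, forall x, `|w1 h X x| <= C & `|G h X| <= C]].
  move=> h; have [/H[X HX]|nh] := boolP (0 < h < h0); first by exists X.
  by exists (fun=> 0).
have [Pm _ [Cp Cp0 HCp]] :=
  proj_orth_phi_bounded T phi psi T0 phi_deriv phi_gt0 phi_even phi_periodic.
have [Ck Ck0 HCk] :=
  phi_coeff_bounded T phi psi T0 phi_deriv phi_gt0 phi_even phi_periodic.
pose g h := G h (X h).
pose k h := phi_coeff T phi (v1 h (X h)).
pose p h := proj_orth_phi T phi (v1 h (X h)).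
pose q h := w1 h (X h).
have [LmE _ _] := Lm_bounded.
have p_orth h : 0 < h < h0 -> orth_phi T phi (p h).
  by move=> /HX[_ _ _ [ev _] _]; exact: Pm.
have q_orth h : 0 < h < h0 -> orth_phi T phi (q h).
  by move=> /HX[_ ev ew _ _]; apply: LmE; rewrite /M; even_periodic.
have comb_orth h s t : 0 < h < h0 ->
    orth_phi T phi (fun x => h ^+ 2 * (s * p h x + t * q h x)).
  by move=> hh; apply/orth_phiM/orth_phiD; apply: orth_phiM; [exact: p_orth|exact: q_orth].
have r1E h : (fun x => h ^+ 2 * (a0 * p h x - b0 * q h x)) =
    (fun x => h ^+ 2 * (a0 * p h x + - b0 * q h x)).
  by apply/funext => x; rewrite mulNr.
have orth_inner f : orth_phi T phi f -> L2per T f /\ inner T f phi = 0.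
  move=> [ef f0]; split; first by apply: L2per_continuous; case: ef.
  by rewrite innerE//; have [] := even_periodicM _ _ _ ef ep_phi.
have kC h : 0 < h < h0 -> `|k h| <= Ck * C.
  by move=> /HX[_ _ _ [ev _] [bv _ _]]; exact: HCk.
have gC h : 0 < h < h0 -> `|g h| <= C by move=> /HX[_ _ _ _ [_ _]].
have coeff_bound h s t : 0 < h < h0 ->
    `|h ^+ 2 * (s * k h + t * g h)| <= (`|s| * (Ck * C) + `|t| * C) * h ^+ 2.
  move=> hh; rewrite normrM mulrC (ger0_norm (sqr_ge0 h)) ler_wpM2r ?sqr_ge0//.
  by rewrite (le_trans (ler_normD _ _))// lerD// normrM ler_wpM2l ?kC ?gC.
have norm_bound h s t : 0 < h < h0 ->
    `|norm2 T (fun x => h ^+ 2 * (s * p h x + t * q h x))| <=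
    Num.sqrt (2 * T) * (`|s| * (Cp * C) + `|t| * C) * h ^+ 2.
  move=> hh; rewrite ger0_norm ?sqrtr_ge0// -mulrA.
  have [ec _] := comb_orth h s t hh.
  have [_ _ _ [ev _] [bv bw _]] := HX _ hh.
  apply: norm2_le => //; first by case: ec.
  move=> x; rewrite normrM mulrC (ger0_norm (sqr_ge0 h)) ler_wpM2r ?sqr_ge0//.
  rewrite (le_trans (ler_normD _ _))// lerD// normrM ler_wpM2l//; last exact: bw.
  exact: HCp.
exists h0; split => //.
exists (fun h => profile1 h (X h)), (fun h => profile2 h (X h)); split.
  move=> h hh; have [XE ev ew [ev1 ew1] _] := HX _ hh.
  have [[_ per1] even1] := profile1_even_periodic h _ ev ew.
  have [[_ per2] even2] := profile2_even_periodic h _ ev ew.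
  by split => //; exact: profile_stationary.
exists (fun h => h ^+ 2 * (a0 * k h - b0 * g h)), (fun h => h ^+ 2 * (b0 * k h + a0 * g h)).
exists (fun h x => h ^+ 2 * (a0 * p h x - b0 * q h x)),
  (fun h x => h ^+ 2 * (b0 * p h x + a0 * q h x)).
split.
- move=> h hh; rewrite r1E.
  have [? ?] := orth_inner _ (comb_orth h a0 (- b0) hh).
  by have [? ?] := orth_inner _ (comb_orth h b0 a0 hh); split.
- move=> h hh x; have [XE _ _ _ _] := HX _ hh.
  by split; [exact: profile1_expansion|exact: profile2_expansion].
- split; apply: (bigO_sqr _ _ _ h00) => h hh; last exact: coeff_bound.
  by rewrite -mulNr; exact: coeff_bound.
- split; apply: (bigO_sqr _ _ _ h00) => h hh; last exact: norm_bound.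
  by rewrite r1E; exact: norm_bound.
Qed.

End Amplitudes.

End Bifurcation.

Theorem theorem1 (R : realType) (a alpha0 sigma0 : R)
    (ha : 1 / Num.sqrt 2 < a < 1) :
  let T := half_period a in
  let phi0 : R -> R := cnoidal a in
  let m1 := inner T (cst 1) phi0 in
  let n2 := inner T phi0 phi0 in
  0 < alpha0 < m1 / n2 ->
  sigma0 = Num.sqrt (m1 ^+ 2 / n2 ^+ 2 - alpha0 ^+ 2) \/
  sigma0 = - Num.sqrt (m1 ^+ 2 / n2 ^+ 2 - alpha0 ^+ 2) ->
  let a0 := sigma0 * (n2 / m1) in
  let b0 := alpha0 * (n2 / m1) in
  let V := Lplus_inv T phi0 (cst 1) in
  let W := Lminus_inv T phi0 (fun x => b0 - alpha0 * phi0 x) in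
  let D := 8 * (inner T (fun x => phi0 x ^+ 2 * V x) W / m1) in
  let Psi1 := fun x => a0 ^+ 2 * V x + b0 * W x in
  let Psi2 := fun x => a0 * b0 * V x - a0 * W x in
  exists h0 : R, 0 < h0 /\
  exists phi1 phi2 : R -> R -> R,
    (forall h : R, 0 < h < h0 ->
      [/\ stationary_solution (alpha0 * h) h (phi1 h) (phi2 h),
          even_fun (phi1 h), even_fun (phi2 h),
          periodic (phi1 h) (2 * T) & periodic (phi2 h) (2 * T)]) /\
    exists (c1 c2 : R -> R) (r1 r2 : R -> R -> R),
    [/\ forall h : R, 0 < h < h0 ->
          [/\ L2per T (r1 h), L2per T (r2 h),
              inner T (r1 h) phi0 = 0 & inner T (r2 h) phi0 = 0],
        forall h : R, 0 < h < h0 -> forall x,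
          phi1 h x = (a0 + b0 / 2 * h * D + c1 h) * phi0 x
                     + h * Psi1 x + r1 h x /\
          phi2 h x = (b0 - a0 / 2 * h * D + c2 h) * phi0 x
                     + h * Psi2 x + r2 h x,
        c1 =O_ (0^'+) (fun h : R => h ^+ 2) /\
        c2 =O_ (0^'+) (fun h : R => h ^+ 2) &
        (fun h => norm2 T (r1 h)) =O_ (0^'+) (fun h : R => h ^+ 2) /\
        (fun h => norm2 T (r2 h)) =O_ (0^'+) (fun h : R => h ^+ 2)].
Proof.
move=> T phi0 m1 n2 halpha hsigma a0 b0.
have T0 : 0 < T := half_period_gt0 a ha.
have [psi [phi_deriv psi_deriv energy phi_gt0 [phi_even phi_periodic]]] := cnoidal_ode a ha.
have /andP[a1 a2] := cnoidal_modulus_bounds a ha.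
pose e := a ^+ 2 - a ^+ 4.
have aa : a ^+ 4 = a ^+ 2 * a ^+ 2 by ring.
have e0 : 0 < e.
  by rewrite /e aa -[X in X - _]mulr1 -mulrBr mulr_gt0//; lra.
(* [1 - 4 e = (2 a^2 - 1)^2], positive since [a^2 > 1/2]. *)
have e1 : 4 * e < 1.
  have : 0 < (2 * a ^+ 2 - 1) ^+ 2 by rewrite exprn_gt0// subr_gt0.
  by rewrite /e aa; lra.
have ep_phi : even_periodic T phi0.
  by split=> //; split=> //; exact: has_deriv_continuous phi_deriv.
have m1E : m1 = period_integral T phi0.
  rewrite /m1 innerE//.
    by congr period_integral; apply/funext => x; rewrite mul1r.
  by have [] := even_periodicM _ _ _ (even_periodic_cst T 1) ep_phi.
have n2E : n2 = period_integral T (fun x => phi0 x * phi0 x).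
  by rewrite /n2 innerE//; have [] := even_periodicM _ _ _ ep_phi ep_phi.
have n2_gt0 : 0 < n2.
  by rewrite n2E; exact: (norm_phi_gt0 T phi0 psi T0).
(* Read off from [halpha]: the interval for [alpha0] is nonempty and [n2] is positive. *)
have m1_gt0 : 0 < m1.
  have /andP[al0 alm] := halpha; have := lt_trans al0 alm.
  by rewrite pmulr_lgt0// invr_gt0.
have m1n : m1 != 0 by rewrite gt_eqF.
have n2n : n2 != 0 by rewrite gt_eqF.
have disc : 0 < m1 ^+ 2 / n2 ^+ 2 - alpha0 ^+ 2.
  have /andP[al0 alm] := halpha; rewrite subr_gt0 -expr_div_n.
  by rewrite ltr_pXn2r// nnegrE ltW// divr_gt0.
have sigma2 : sigma0 ^+ 2 = m1 ^+ 2 / n2 ^+ 2 - alpha0 ^+ 2.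
  by case: hsigma => ->; rewrite ?sqrrN sqr_sqrtr// ltW.
have ab1 : a0 ^+ 2 + b0 ^+ 2 = 1.
  by rewrite /a0 /b0 !exprMn sigma2 /m1; field; rewrite n2n m1n.
(* The strict upper bound on [alpha0] makes [sigma0] nonzero; this is the nondegeneracy of the
   reduced equation. *)
have a0_neq0 : a0 != 0.
  rewrite mulf_neq0 ?mulf_neq0 ?invr_eq0//.
  by apply/eqP => s0; move: disc; rewrite -sigma2 s0 expr0n ltxx.
have b0E : b0 * period_integral T phi0 =
    alpha0 * period_integral T (fun x => phi0 x * phi0 x).
  by rewrite -m1E -n2E /b0; field.
have hLp := Lplus_solution_bounded T e phi0 psi T0 e0 e1 phi_deriv psi_deriv energy
  phi_gt0 phi_even phi_periodic.
have hLm := Lminus_solution_bounded T phi0 psi T0 phi_deriv psi_deriv phi_gt0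
  phi_even phi_periodic.
have dLp := Lplus_solution_deriv T e phi0 psi e0 e1 phi_deriv psi_deriv energy
  phi_even phi_periodic.
have dLm := Lminus_solution_deriv T phi0 psi phi_deriv psi_deriv phi_gt0 phi_even phi_periodic.
have VE := Lplus_inv1 T e phi0 psi T0 e1 phi_deriv psi_deriv energy phi_even
  phi_periodic _ hLp dLp.
have WE := Lminus_invE T phi0 psi T0 phi_deriv phi_even phi_periodic _ hLm dLm _
  (Lminus_rhs_orth T phi0 psi phi_deriv phi_even phi_periodic _ _ b0E).
move=> V W D Psi1 Psi2.
pose V' x := (1 - 2 * phi0 x ^+ 2) / (1 - 4 * e).
pose W' := Lminus_solution T phi0 (fun x => b0 - alpha0 * phi0 x).
have ep_V' : even_periodic T V' by rewrite /V'; even_periodic.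
have ep_W' : even_periodic T W'.
  have [LmE _ _] := hLm; apply: (LmE _ _).1; even_periodic.
have DE : D = 8 * (period_integral T (fun x => phi0 x ^+ 2 * V' x * W' x)
    / period_integral T phi0).
  rewrite /D -m1E /V /W VE WE innerE//.
  have [pc _] : even_periodic T (fun x => phi0 x ^+ 2 * V' x * W' x) by even_periodic.
  exact: pc.
rewrite /Psi1 /Psi2 DE /V /W VE WE.
exact: (bifurcation T e phi0 psi T0 e1 phi_deriv psi_deriv energy phi_gt0
  phi_even phi_periodic _ _ hLp hLm dLp dLm alpha0 a0 b0 ab1 a0_neq0 b0E).
Qed.
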